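(* Let $\mathcal{C}$ be a small preadditive category, $\mathcal{I}$ an ideal in $\mathcal{C}$ and $\pi:\mathcal{C}\to\mathcal{C}/\mathcal{I}$ the canonical functor. Let $G\in\mathrm{Mod}(\mathcal{C})$ and let $0\to G\to I_{0}\to I_{1}\to\cdots$ be an injective coresolution of $G$. For $1\leq k\leq\infty$, the following conditions are equivalent. (a) $0\to\overline{\mathrm{Tr}}_{\frac{\mathcal{C}}{\mathcal{I}}}(G)\to\overline{\mathrm{Tr}}_{\frac{\mathcal{C}}{\mathcal{I}}}(I_{0})\to\overline{\mathrm{Tr}}_{\frac{\mathcal{C}}{\mathcal{I}}}(I_{1})\to\cdots\to\overline{\mathrm{Tr}}_{\frac{\mathcal{C}}{\mathcal{I}}}(I_{k})$ is the beginning of an injective coresolution of $\overline{\mathrm{Tr}}_{\frac{\mathcal{C}}{\mathcal{I}}}(G)\in\mathrm{Mod}(\mathcal{C}/\mathcal{I})$. (b) $\mathbb{EXT}^{i}_{\mathcal{C}}(\mathcal{C}/\mathcal{I},G)=0$ for all $1\leq i\leq k$. (c) For $F\in\mathrm{Mod}(\mathcal{C}/\mathcal{I})$ the canonical morphisms $$\varphi^{i}_{F,G}:\mathrm{Ext}^{i}_{\mathrm{Mod}(\mathcal{C}/\mathcal{I})}(F,\overline{\mathrm{Tr}}_{\frac{\mathcal{C}}{\mathcal{I}}}(G))\longrightarrow\mathrm{Ext}^{i}_{\mathrm{Mod}(\mathcal{C})}(\pi_{\ast}(F),G)$$ are isomorphisms for $1\leq i\leq k$.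
   Context: $\mathrm{Mod}(\mathcal{C})$ is the category of additive covariant functors $\mathcal{C}\to\mathbf{Ab}$. An ideal $\mathcal{I}$ of $\mathcal{C}$ is a family of subgroups $\mathcal{I}(A,B)\subseteq\mathrm{Hom}_{\mathcal{C}}(A,B)$ closed under composition on either side with arbitrary morphisms. The quotient category $\mathcal{C}/\mathcal{I}$ has the same objects as $\mathcal{C}$ and $\mathrm{Hom}_{\mathcal{C}/\mathcal{I}}(A,B)=\mathrm{Hom}_{\mathcal{C}}(A,B)/\mathcal{I}(A,B)$; $\pi_{\ast}:\mathrm{Mod}(\mathcal{C}/\mathcal{I})\to\mathrm{Mod}(\mathcal{C})$ is the functor $F\mapsto F\circ\pi$. For $C\in\mathcal{C}$ put $M_C=\mathrm{Hom}_{\mathcal{C}}(C,-)/\mathcal{I}(C,-)$. $\mathrm{Tr}_{\frac{\mathcal{C}}{\mathcal{I}}}(G)\subseteq G$ is the trace of the family $\{M_C\}_{C\in\mathcal{C}}$ in $G$ (the sum of the images of all morphisms $M_C\to G$, $C\in\mathcal{C}$). It lies in $\mathrm{Ann}(\mathcal{I})=\{F\in\mathrm{Mod}(\mathcal{C}) : F(f)=0\text{ for all } f\in\mathcal{I}(A,B)\text{ and all }A,B\in\mathcal{C}\}$, and $\overline{\mathrm{Tr}}_{\frac{\mathcal{C}}{\mathcal{I}}}=\Omega\circ\mathrm{Tr}_{\frac{\mathcal{C}}{\mathcal{I}}}$, where $\Omega:\mathrm{Ann}(\mathcal{I})\to\mathrm{Mod}(\mathcal{C}/\mathcal{I})$ is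 inverse to $\pi_{\ast}$. The functor $\overline{\mathrm{Tr}}_{\frac{\mathcal{C}}{\mathcal{I}}}$ is right adjoint to $\pi_{\ast}$ and is isomorphic to $\mathcal{C}(\frac{\mathcal{C}}{\mathcal{I}},-)$, given by $\mathcal{C}(\frac{\mathcal{C}}{\mathcal{I}},M)(C)=\mathrm{Hom}_{\mathrm{Mod}(\mathcal{C})}(M_C,M)$. $\mathbb{EXT}^{i}_{\mathcal{C}}(\mathcal{C}/\mathcal{I},-):\mathrm{Mod}(\mathcal{C})\to\mathrm{Mod}(\mathcal{C}/\mathcal{I})$ is the $i$-th right derived functor of $\mathcal{C}(\frac{\mathcal{C}}{\mathcal{I}},-)$; thus $\mathbb{EXT}^{i}_{\mathcal{C}}(\mathcal{C}/\mathcal{I},M)(C)=\mathrm{Ext}^{i}_{\mathrm{Mod}(\mathcal{C})}(M_C,M)$. The morphism $\varphi^i_{F,G}$ is the composite of the map $\mathrm{Ext}^{i}_{\mathrm{Mod}(\mathcal{C}/\mathcal{I})}(F,\overline{\mathrm{Tr}}_{\frac{\mathcal{C}}{\mathcal{I}}}(G))\to\mathrm{Ext}^{i}_{\mathrm{Mod}(\mathcal{C})}(\pi_{\ast}F,\pi_{\ast}\overline{\mathrm{Tr}}_{\frac{\mathcal{C}}{\mathcal{I}}}(G))$ induced by the exact functor $\pi_{\ast}$ with the map induced by the counit $\pi_{\ast}\overline{\mathrm{Tr}}_{\frac{\mathcal{C}}{\mathcal{I}}}(G)=\mathrm{Tr}_{\frac{\mathcal{C}}{\mathcal{I}}}(G)\hookrightarrow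 G$.
   Formalization: In (a), for finite k, ''beginning of an injective coresolution'' also demands exactness at Tr(I_k) with respect to Tr(I_k)→Tr(I_{k+1}); without it the claim fails, e.g. C=Z, I=2Z, G=Z/2, k=1, where EXT^1=Z/2. *)

(* Defs.v *)
From HB Require Import structures.
From mathcomp Require Import all_boot all_algebra.
From mathcomp Require Import boolp.

Set Implicit Arguments.
Unset Strict Implicit.
Unset Printing Implicit Defensive.

Import GRing.Theory.
Local Open Scope ring_scope.
Local Open Scope quotient_scope.

(** [zmodType] plays the role of Ab.  Membership predicates are boolean, which
    is no restriction in the presence of the classical axioms of [boolp].  The
    quotient of [V] by [S : zmodClosed V] is [Quotient.quot S]. *)

Record subgrp (V : zmodType) (S : zmodClosed V) :=
  SubGrp { sgval : V; sgvalP : sgval \in S }.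

HB.instance Definition _ V S := [isSub for @sgval V S].
HB.instance Definition _ V S := [Choice of @subgrp V S by <:].
HB.instance Definition _ V S := [SubChoice_isSubZmodule of @subgrp V S by <:].

Lemma quot_eqP (V : zmodType) (S : zmodClosed V) (x y : V) :
  \pi_(Quotient.quot S) x = \pi_(Quotient.quot S) y <-> x - y \in S.
Proof. by rewrite Quotient.idealrBE; split=> [->|/eqP]. Qed.

Lemma quot_repr (V : zmodType) (S : zmodClosed V) (x : V) :
  repr (\pi_(Quotient.quot S) x) - x \in S.
Proof. by apply/quot_eqP; rewrite reprK. Qed.

Lemma quot_piD (V : zmodType) (S : zmodClosed V) :
  {morph \pi_(Quotient.quot S) : x y / x + y}.
Proof. by move=> x y; rewrite !piE. Qed.

Record cochain := Cochain {
  cgrp :> nat -> zmodType;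
  cdiff : forall n, {additive cgrp n -> cgrp n.+1};
  cdiff2 : forall n x, cdiff n.+1 (cdiff n x) = 0 }.

Arguments cdiff : clear implicits.

Record cochain_map (X Y : cochain) := CochainMap {
  cmap :> forall n, {additive X n -> Y n};
  cmap_comm : forall n x, cmap n.+1 (cdiff X n x) = cdiff Y n (cmap n x) }.

Section Cohomology.
Variables (X : cochain) (n : nat).

Definition cocycle : {pred X n} := fun x => cdiff X n x == 0.

Fact cocycle_closed : zmod_closed cocycle.
Proof.
split=> [|x y]; rewrite !unfold_in ?raddf0 // => /eqP x0 /eqP y0.
by rewrite raddfB x0 y0 subrr.
Qed.
HB.instance Definition _ := GRing.isZmodClosed.Build (X n) cocycle cocycle_closed.

End Cohomology.
Arguments cocycle : clear implicits.

Definition bounds (X : cochain) (n : nat) : X n -> Prop :=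
  match n with
  | 0 => fun x => x = 0
  | m.+1 => fun x => exists y, cdiff X m y = x
  end.

Section CohomologyGroup.
Variables (X : cochain) (n : nat).

Definition coboundary : {pred subgrp (cocycle X n)} :=
  fun x => `[< bounds (sgval x) >].

Fact coboundary_closed : zmod_closed coboundary.
Proof.
rewrite /coboundary; split=> [|x y]; rewrite !unfold_in.
  by apply/asboolP; case: n => [|m] //=; exists 0; rewrite raddf0.
move=> /asboolP + /asboolP + ; move: x y; case: n => [|m] x y /=.
  by move=> x0 y0; apply/asboolP; rewrite x0 y0 subrr.
by move=> [a ax] [b bx]; apply/asboolP; exists (a - b); rewrite raddfB ax bx.
Qed.
HB.instance Definition _ :=
  GRing.isZmodClosed.Build (subgrp (cocycle X n)) coboundary coboundary_closed.

Definition coh : zmodType := Quotient.quot coboundary.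

Definition coh_class (x : subgrp (cocycle X n)) : coh :=
  \pi_(Quotient.quot coboundary) x.

Lemma coh_class_repr (q : coh) : coh_class (repr q) = q.
Proof. exact: reprK. Qed.

Lemma coh_classD : {morph coh_class : x y / x + y}.
Proof. exact: quot_piD. Qed.

End CohomologyGroup.
Arguments coboundary : clear implicits.

Section CohomologyMap.
Variables (X Y : cochain) (f : cochain_map X Y) (n : nat).

Fact cocycle_map_proof (x : subgrp (cocycle X n)) :
  f n (sgval x) \in cocycle Y n.
Proof.
case: x => x /=; rewrite !unfold_in => /eqP x0.
by rewrite -cmap_comm x0 raddf0.
Qed.

Definition cocycle_map (x : subgrp (cocycle X n)) : subgrp (cocycle Y n) :=
  SubGrp (cocycle_map_proof x).

Fact cocycle_map_is_additive : zmod_morphism cocycle_map.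
Proof. by move=> x y; apply/val_inj; rewrite /= raddfB. Qed.
HB.instance Definition _ :=
  GRing.isZmodMorphism.Build _ _ cocycle_map cocycle_map_is_additive.

Lemma coboundary_map x : x \in coboundary X n -> cocycle_map x \in coboundary Y n.
Proof.
case: x => x xZ; rewrite !unfold_in => /asboolP xB; apply/asboolP.
move: x xZ xB => /=; case: n => [|m] x /= _; first by move=> ->; rewrite raddf0.
by move=> [y <-]; exists (f m y); rewrite cmap_comm.
Qed.

Definition coh_map (q : coh X n) : coh Y n := coh_class (cocycle_map (repr q)).

Lemma coh_map_class x : coh_map (coh_class x) = coh_class (cocycle_map x).
Proof.
by apply/quot_eqP; rewrite -raddfB; apply/coboundary_map/quot_repr.
Qed.

Fact coh_map_is_additive : nmod_morphism coh_map.
Proof.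
have mapD : {morph coh_map : x y / x + y}.
  move=> x y; rewrite -[x]coh_class_repr -[y]coh_class_repr -coh_classD.
  by rewrite !coh_map_class raddfD coh_classD.
by split=> //; apply: (addrI (coh_map 0)); rewrite -mapD !addr0.
Qed.
HB.instance Definition _ :=
  GRing.isNmodMorphism.Build _ _ coh_map coh_map_is_additive.

End CohomologyMap.
Arguments coh_map {X Y} f n q.

(** Smallness is enforced by universes: morphisms of modules form a [zmodType]
    below, so the type of objects lives in the universe of abelian groups. *)
Record preadditive := Preadditive {
  ob :> Type;
  hom : ob -> ob -> zmodType;
  idm : forall A, hom A A;
  comp : forall A B D, hom B D -> hom A B -> hom A D;
  comp_idl : forall A B (f : hom A B), comp (idm B) f = f;
  comp_idr : forall A B (f : hom A B), comp f (idm A) = f;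
  comp_assoc : forall A B D E (h : hom D E) (g : hom B D) (f : hom A B),
    comp h (comp g f) = comp (comp h g) f;
  comp_addl : forall A B D (g g' : hom B D) (f : hom A B),
    comp (g + g') f = comp g f + comp g' f;
  comp_addr : forall A B D (g : hom B D) (f f' : hom A B),
    comp g (f + f') = comp g f + comp g f' }.

Arguments idm {p} A.
Notation "g \oc f" := (comp g f) (at level 40, left associativity).

Section PreadditiveTheory.
Variable C : preadditive.

Lemma comp_subl A B D (g g' : hom (p := C) B D) (f : hom A B) :
  (g - g') \oc f = g \oc f - g' \oc f.
Proof. by apply/eqP; rewrite eq_sym subr_eq -comp_addl subrK. Qed.

Lemma comp_subr A B D (g : hom (p := C) B D) (f f' : hom A B) :
  g \oc (f - f') = g \oc f - g \oc f'.
Proof. by apply/eqP; rewrite eq_sym subr_eq -comp_addr subrK. Qed.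

End PreadditiveTheory.

(** Objects of Mod(C): additive covariant functors C -> Ab. *)
Record module (C : preadditive) := Module {
  mob :> C -> zmodType;
  mact : forall A B, hom A B -> {additive mob A -> mob B};
  mact_id : forall A x, mact (idm A) x = x;
  mact_comp : forall A B D (g : hom B D) (f : hom A B) x,
    mact (g \oc f) x = mact g (mact f x);
  mactD : forall A B (f g : hom A B) x, mact (f + g) x = mact f x + mact g x }.

Arguments mact {C} M {A B} f : rename.

Section ModuleTheory.
Variables (C : preadditive) (M : module C).

Lemma mactB A B (f g : hom A B) x : mact M (f - g) x = mact M f x - mact M g x.
Proof. by apply/eqP; rewrite eq_sym subr_eq -mactD subrK. Qed.

End ModuleTheory.

Record mhom (C : preadditive) (M N : module C) := MHom {
  mapp :> forall A, M A -> N A;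
  mapp_additive : forall A, zmod_morphism (@mapp A);
  mapp_nat : forall A B (f : hom A B) x,
    mapp (mact M f x) = mact N f (mapp x) }.

Arguments mapp {C M N} t A x : rename.
Arguments mapp_additive {C M N} t A : rename.

HB.instance Definition _ C M N (t : @mhom C M N) A :=
  GRing.isZmodMorphism.Build (M A) (N A) (mapp t A) (mapp_additive t A).

Lemma mhomP C (M N : module C) (s t : mhom M N) :
  (forall A x, s A x = t A x) -> s = t.
Proof.
case: s t => [s s1 s2] [t t1 t2] /= st.
have {}st : s = t by apply: functional_extensionality_dep => A; apply/funext/st.
by subst t; congr MHom; apply: Prop_irrelevance.
Qed.

HB.instance Definition _ C M N := gen_eqMixin (@mhom C M N).
HB.instance Definition _ C M N := gen_choiceMixin (@mhom C M N).

Section MHomZmod.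
Variables (C : preadditive) (M N : module C).
Implicit Types s t : mhom M N.

Program Definition mhom_zero : mhom M N := @MHom C M N (fun A x => 0) _ _.
Next Obligation. by move=> x y; rewrite subr0. Qed.
Next Obligation. by rewrite raddf0. Qed.

Program Definition mhom_opp t : mhom M N := @MHom C M N (fun A x => - t A x) _ _.
Next Obligation. by move=> x y; rewrite raddfB opprB opprK addrC. Qed.
Next Obligation. by rewrite mapp_nat raddfN. Qed.

Program Definition mhom_add s t : mhom M N :=
  @MHom C M N (fun A x => s A x + t A x) _ _.
Next Obligation. by move=> x y; rewrite !raddfB opprD addrACA. Qed.
Next Obligation. by rewrite !mapp_nat raddfD. Qed.

Fact mhom_addA : associative mhom_add.
Proof. by move=> r s t; apply: mhomP => A x; rewrite /= addrA. Qed.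
Fact mhom_addC : commutative mhom_add.
Proof. by move=> s t; apply: mhomP => A x; rewrite /= addrC. Qed.
Fact mhom_add0 : left_id mhom_zero mhom_add.
Proof. by move=> t; apply: mhomP => A x; rewrite /= add0r. Qed.
Fact mhom_addN : left_inverse mhom_zero mhom_opp mhom_add.
Proof. by move=> t; apply: mhomP => A x; rewrite /= addNr. Qed.

HB.instance Definition _ :=
  GRing.isZmodule.Build (mhom M N) mhom_addA mhom_addC mhom_add0 mhom_addN.

End MHomZmod.

Lemma mhomBE C (M N : module C) (s t : mhom M N) A x :
  (s - t) A x = s A x - t A x.
Proof. by []. Qed.

Program Definition mid C (M : module C) : mhom M M := @MHom C M M (fun A x => x) _ _.
Next Obligation. by []. Qed.

Program Definition mcomp C (M N P : module C) (t : mhom N P) (s : mhom M N) :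
  mhom M P := @MHom C M P (fun A x => t A (s A x)) _ _.
Next Obligation. by move=> x y; rewrite !raddfB. Qed.
Next Obligation. by rewrite !mapp_nat. Qed.

Notation "t \om s" := (mcomp t s) (at level 40, left associativity).

Section PostComposition.
Variables (C : preadditive) (F M N : module C) (t : mhom M N).

Definition postcomp (s : mhom F M) : mhom F N := t \om s.

Fact postcomp_is_additive : zmod_morphism postcomp.
Proof. by move=> r s; apply: mhomP => A x; rewrite mhomBE /= raddfB. Qed.
HB.instance Definition _ :=
  GRing.isZmodMorphism.Build _ _ postcomp postcomp_is_additive.

End PostComposition.
Arguments postcomp {C} F {M N} t s.

(** Monomorphisms and exactness in Mod(C) are objectwise. *)
Definition mono C (M N : module C) (t : mhom M N) : Prop :=
  forall A, injective (t A).

Definition exact_at C (M N P : module C) (s : mhom M N) (t : mhom N P) : Prop :=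
  forall A (y : N A), t A y = 0 <-> exists x, s A x = y.

Definition injective_module C (E : module C) : Prop :=
  forall (M N : module C) (i : mhom M N), mono i ->
  forall f : mhom M E, exists g : mhom N E, g \om i = f.

Record complex (C : preadditive) := Complex {
  cxm :> nat -> module C;
  cxd : forall n, mhom (cxm n) (cxm n.+1);
  cxd2 : forall n, cxd n.+1 \om cxd n = 0 }.

Arguments cxd {C} X n : rename.

Lemma cxd2E C (X : complex C) n A x : cxd X n.+1 A (cxd X n A x) = 0.
Proof. exact: (congr1 (fun t : mhom _ _ => t A x) (cxd2 X n)). Qed.

Record complex_map (C : preadditive) (X Y : complex C) := ComplexMap {
  cxmap :> forall n, mhom (X n) (Y n);
  cxmap_comm : forall n, cxmap n.+1 \om cxd X n = cxd Y n \om cxmap n }.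

Lemma cxmap_commE C (X Y : complex C) (u : complex_map X Y) n A x :
  u n.+1 A (cxd X n A x) = cxd Y n A (u n A x).
Proof. exact: (congr1 (fun t : mhom _ _ => t A x) (cxmap_comm u n)). Qed.

Record aug_complex (C : preadditive) (G : module C) := AugComplex {
  acx :> complex C;
  aug : mhom G (acx 0%N);
  aug_d : cxd acx 0 \om aug = 0 }.

Lemma aug_dE C (G : module C) (X : aug_complex G) A x :
  cxd X 0 A (aug X A x) = 0.
Proof. exact: (congr1 (fun t : mhom _ _ => t A x) (aug_d X)). Qed.

(** Bounds ranging over the nonnegative integers and oo, the latter being
    [None]. *)
Definition le_oo (i : nat) (k : option nat) : Prop :=
  if k is Some n then (i <= n)%N else True.

(** 0 -> G -> X 0 -> X 1 -> ... agrees in degrees at most [k] with an injective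
    coresolution of G: the modules in these degrees are injective and the
    complex is exact at G and in these degrees, where exactness at [X k]
    involves the differential leaving [X k]. *)
Definition begins_injective_coresolution (k : option nat) C (G : module C)
    (X : aug_complex G) : Prop :=
  [/\ forall n, le_oo n k -> injective_module (X n),
      mono (aug X), exact_at (aug X) (cxd X 0)
    & forall n, le_oo n.+1 k -> exact_at (cxd X n) (cxd X n.+1)].

Record inj_coresolution (C : preadditive) (G : module C) := InjCoresolution {
  icx :> aug_complex G;
  icxP : begins_injective_coresolution None icx }.

Definition lifts C (M N : module C) (g : mhom M N)
    (X : aug_complex M) (Y : aug_complex N) (u : complex_map X Y) : Prop :=
  u 0%N \om aug X = aug Y \om g.
Arguments lifts {C M N} g X Y u.

Program Definition hom_cx C (F : module C) (X : complex C) : cochain :=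
  @Cochain (fun n => mhom F (X n)) (fun n => postcomp F (cxd X n)) _.
Next Obligation. by apply: mhomP => A y /=; rewrite cxd2E. Qed.

Program Definition hom_cx_map C (F : module C) (X Y : complex C)
    (u : complex_map X Y) : cochain_map (hom_cx F X) (hom_cx F Y) :=
  @CochainMap (hom_cx F X) (hom_cx F Y) (fun n => postcomp F (u n)) _.
Next Obligation. by apply: mhomP => A y /=; rewrite cxmap_commE. Qed.

(** Ext^i(F, G), computed with the injective coresolution [J] of G.  The
    coresolution is an argument, so that statements about Ext quantify over
    it. *)
Definition Ext C (i : nat) (F G : module C) (J : inj_coresolution G) : zmodType :=
  coh (hom_cx F J) i.

Definition Ext_map C (i : nat) (F M N : module C) (J : inj_coresolution M)
    (K : inj_coresolution N) (u : complex_map J K) : Ext i F J -> Ext i F K :=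
  coh_map (hom_cx_map F u) i.
Arguments Ext_map {C} i F {M N J K} u.

Section CohomologyModule.
Variables (C : preadditive) (X : complex C).

Program Definition eval_cx (A : C) : cochain :=
  @Cochain (fun n => X n A) (fun n => mapp (cxd X n) A) _.
Next Obligation. exact: cxd2E. Qed.

Program Definition eval_cx_map A B (f : hom A B) :
    cochain_map (eval_cx A) (eval_cx B) :=
  @CochainMap (eval_cx A) (eval_cx B) (fun n => mact (X n) f) _.
Next Obligation. by rewrite mapp_nat. Qed.

Section Degree.
Variable n : nat.

Definition coh_act A B (f : hom A B) :
    {additive coh (eval_cx A) n -> coh (eval_cx B) n} :=
  coh_map (eval_cx_map f) n.

Lemma coh_act_class A B (f : hom A B) x :
  coh_act f (coh_class x) = coh_class (cocycle_map (eval_cx_map f) x).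
Proof. exact: coh_map_class. Qed.

Fact coh_act_id A x : coh_act (idm A) x = x.
Proof.
rewrite -[x]coh_class_repr coh_act_class; congr coh_class.
by apply/val_inj; rewrite /= mact_id.
Qed.

Fact coh_act_comp A B D (g : hom B D) (f : hom A B) x :
  coh_act (g \oc f) x = coh_act g (coh_act f x).
Proof.
rewrite -[x]coh_class_repr !coh_act_class; congr coh_class.
by apply/val_inj; rewrite /= mact_comp.
Qed.

Fact coh_actD A B (f g : hom A B) x : coh_act (f + g) x = coh_act f x + coh_act g x.
Proof.
rewrite -[x]coh_class_repr !coh_act_class -coh_classD; congr coh_class.
by apply/val_inj; rewrite /= mactD.
Qed.

Definition coh_module : module C := Module coh_act_id coh_act_comp coh_actD.

End Degree.

End CohomologyModule.

Definition zero_module C (M : module C) : Prop := forall A (x : M A), x = 0.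

Record ideal (C : preadditive) := Ideal {
  isub :> forall A B : C, zmodClosed (hom A B);
  ideal_compl : forall A B D (g : hom B D) (f : hom A B),
    f \in isub A B -> g \oc f \in isub A D;
  ideal_compr : forall A B D (g : hom B D) (f : hom A B),
    g \in isub B D -> g \oc f \in isub A D }.

Section QuotientCategory.
Variables (C : preadditive) (I : ideal C).

Definition qhom (A B : C) : zmodType := Quotient.quot (I A B).

Definition qproj A B (f : hom A B) : qhom A B := \pi_(Quotient.quot (I A B)) f.

Definition qcomp A B D (g : qhom B D) (f : qhom A B) : qhom A D :=
  qproj (repr g \oc repr f).

Lemma qproj_repr A B (f : qhom A B) : qproj (repr f) = f.
Proof. exact: reprK. Qed.

Lemma qprojD A B (f g : hom A B) : qproj (f + g) = qproj f + qproj g.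
Proof. exact: quot_piD. Qed.

Lemma qprojP A B (f g : hom A B) : qproj f = qproj g <-> f - g \in I A B.
Proof. exact: quot_eqP. Qed.

Lemma qcomp_proj A B D (g : hom B D) (f : hom A B) :
  qcomp (qproj g) (qproj f) = qproj (g \oc f).
Proof.
apply/qprojP; set g' := repr _; set f' := repr _.
have -> : g' \oc f' - g \oc f = (g' - g) \oc f' + g \oc (f' - f).
  by rewrite comp_subl comp_subr addrA subrK.
by apply: rpredD; [apply: ideal_compr | apply: ideal_compl]; apply: quot_repr.
Qed.

Program Definition quot_cat : preadditive :=
  @Preadditive C qhom (fun A => qproj (idm A)) qcomp _ _ _ _ _.
Next Obligation. by rewrite -[f]qproj_repr qcomp_proj comp_idl. Qed.
Next Obligation. by rewrite -[f]qproj_repr qcomp_proj comp_idr. Qed.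
Next Obligation.
by rewrite -[f]qproj_repr -[g]qproj_repr -[h]qproj_repr !qcomp_proj comp_assoc.
Qed.
Next Obligation.
rewrite -[f]qproj_repr -[g]qproj_repr -[g']qproj_repr.
by rewrite -qprojD !qcomp_proj comp_addl qprojD.
Qed.
Next Obligation.
rewrite -[f]qproj_repr -[g]qproj_repr -[f']qproj_repr.
by rewrite -qprojD !qcomp_proj comp_addr qprojD.
Qed.

(** The canonical functor pi : C -> C/I is [qproj] on morphisms and the identity
    on objects; [pi_mod] is the functor F |-> F o pi. *)
Definition qpi (A B : C) (f : hom A B) : @hom quot_cat A B := qproj f.

Lemma qpi_comp (A B D : C) (g : hom B D) (f : hom A B) :
  qpi (g \oc f) = qpi g \oc qpi f.
Proof. by rewrite /qpi -qcomp_proj. Qed.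

Lemma qpiD (A B : C) (f g : hom A B) : qpi (f + g) = qpi f + qpi g.
Proof. exact: qprojD. Qed.

Program Definition pi_mod (F : module quot_cat) : module C :=
  @Module C F (fun (A B : C) (f : hom A B) => mact F (qpi f)) _ _ _.
Next Obligation. exact: (mact_id (m := F)). Qed.
Next Obligation. by rewrite qpi_comp mact_comp. Qed.
Next Obligation. by rewrite qpiD mactD. Qed.

Program Definition pi_mhom (F F' : module quot_cat) (t : mhom F F') :
    mhom (pi_mod F) (pi_mod F') :=
  @MHom C (pi_mod F) (pi_mod F') (fun A x => t A x) _ _.
Next Obligation. exact: mapp_additive. Qed.
Next Obligation. exact: mapp_nat. Qed.

Lemma pi_mhom_is_additive (F F' : module quot_cat) : zmod_morphism (@pi_mhom F F').
Proof. by move=> s t; apply: mhomP. Qed.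
HB.instance Definition _ F F' :=
  GRing.isZmodMorphism.Build _ _ (@pi_mhom F F') (@pi_mhom_is_additive F F').

Program Definition pi_cx (X : complex quot_cat) : complex C :=
  @Complex C (fun n => pi_mod (X n)) (fun n => pi_mhom (cxd X n)) _.
Next Obligation. by apply: mhomP => A x; apply: (cxd2E (X := X)). Qed.

Program Definition pi_aug (G : module quot_cat) (X : aug_complex G) :
    aug_complex (pi_mod G) :=
  @AugComplex C (pi_mod G) (pi_cx X) (pi_mhom (aug X)) _.
Next Obligation. by apply: mhomP => A x; apply: (aug_dE X). Qed.

Program Definition pi_hom_cx (F : module quot_cat) (X : complex quot_cat) :
    cochain_map (hom_cx F X) (hom_cx (pi_mod F) (pi_cx X)) :=
  @CochainMap (hom_cx F X) (hom_cx (pi_mod F) (pi_cx X))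
    (fun n => @pi_mhom F (X n)) _.
Next Obligation. by apply: mhomP. Qed.

(** The map Ext^i(F, G) -> Ext^i(pi_* F, pi_* G) induced by the exact functor
    pi_*, where [u] compares the image under pi_* of the coresolution of G with
    the coresolution of pi_* G. *)
Definition pi_Ext (i : nat) (F G : module quot_cat) (J : inj_coresolution G)
    (K : inj_coresolution (pi_mod G)) (u : complex_map (pi_cx J) K) :
    Ext i F J -> Ext i (pi_mod F) K :=
  coh_map (hom_cx_map (pi_mod F) u) i \o coh_map (pi_hom_cx F J) i.
Arguments pi_Ext i F {G J K} u.

(** M_A = Hom(A, -)/I(A, -), a module over C. *)
Section MI.
Variable A : C.

Definition MI_act (X Y : C) (f : hom X Y) (h : @hom quot_cat A X) :
  @hom quot_cat A Y := qpi f \oc h.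

Fact MI_act_is_additive X Y (f : hom X Y) : zmod_morphism (MI_act f).
Proof. by move=> g h; exact: comp_subr. Qed.
HB.instance Definition _ X Y f :=
  GRing.isZmodMorphism.Build _ _ (@MI_act X Y f) (MI_act_is_additive f).

Program Definition MI : module C :=
  @Module C (fun X => @hom quot_cat A X) (fun X Y f => @MI_act X Y f) _ _ _.
Next Obligation. by rewrite /MI_act (comp_idl (p := quot_cat)). Qed.
Next Obligation. by rewrite /MI_act qpi_comp comp_assoc. Qed.
Next Obligation. by rewrite /MI_act qpiD comp_addl. Qed.

End MI.

Program Definition MI_map (A B : C) (f : @hom quot_cat A B) : mhom (MI B) (MI A) :=
  @MHom C (MI B) (MI A) (fun X h => h \oc f) _ _.
Next Obligation. by move=> g h; exact: (comp_subl (C := quot_cat)). Qed.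
Next Obligation. by rewrite /= /MI_act comp_assoc. Qed.

(** The functor C(C/I, -) : Mod(C) -> Mod(C/I). *)
Section CI.
Variable M : module C.

Definition CI_act A B (f : @hom quot_cat A B) (t : mhom (MI A) M) : mhom (MI B) M :=
  t \om MI_map f.

Fact CI_act_is_additive A B (f : @hom quot_cat A B) : zmod_morphism (CI_act f).
Proof. by move=> s t; apply: mhomP. Qed.
HB.instance Definition _ A B f :=
  GRing.isZmodMorphism.Build _ _ (@CI_act A B f) (CI_act_is_additive f).

Program Definition CI : module quot_cat :=
  @Module quot_cat (fun A => mhom (MI A) M) (fun A B f => @CI_act A B f) _ _ _.
Next Obligation.
by apply: mhomP => X h; apply: (congr1 (mapp x X)); apply: comp_idr.
Qed.
Next Obligation.
by apply: mhomP => X h; apply: (congr1 (mapp x X)); apply: comp_assoc.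
Qed.
Next Obligation.
apply: mhomP => X h; transitivity (x X ((h \oc f) + (h \oc g))).
  by apply: (congr1 (mapp x X)); apply: comp_addr.
exact: raddfD.
Qed.

End CI.

Program Definition CI_map (M N : module C) (t : mhom M N) : mhom (CI M) (CI N) :=
  @MHom quot_cat (CI M) (CI N) (fun A => postcomp (MI A) t) _ _.
Next Obligation. exact: raddfB. Qed.
Next Obligation. by apply: mhomP. Qed.

Program Definition CI_cx (X : complex C) : complex quot_cat :=
  @Complex quot_cat (fun n => CI (X n)) (fun n => CI_map (cxd X n)) _.
Next Obligation.
by apply: mhomP => A t; apply: mhomP => B x /=; rewrite cxd2E.
Qed.

(** EXT^i(C/I, G), the value at G of the i-th right derived functor of [CI],
    computed with the injective coresolution [J] of G. *)
Definition EXT (i : nat) (G : module C) (J : inj_coresolution G) :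
  module quot_cat := coh_module (CI_cx J) i.

Section Trace.
Variable G : module C.

(** Finite sums of elements of images of morphisms M_A -> G. *)
Definition trace (X : C) : {pred G X} := fun x =>
  `[< exists s : seq {A : C & (mhom (MI A) G * MI A X)%type},
        x = \sum_(p <- s) (projT2 p).1 X (projT2 p).2 >].

Fact trace_closed X : zmod_closed (@trace X).
Proof.
split=> [|x y]; rewrite !unfold_in.
  by apply/asboolP; exists [::]; rewrite big_nil.
move=> /asboolP [s ->] /asboolP [r ->]; apply/asboolP.
exists (s ++ [seq existT (fun A => (mhom (MI A) G * MI A X)%type) (projT1 p)
                ((projT2 p).1, - (projT2 p).2) | p <- r]).
rewrite big_cat big_map /= -sumrN; congr (_ + _).
by apply: eq_bigr => p _; rewrite raddfN.
Qed.
HB.instance Definition _ X :=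
  GRing.isZmodClosed.Build (G X) (@trace X) (trace_closed X).

Fact trace_act X Y (f : hom X Y) x : x \in @trace X -> mact G f x \in @trace Y.
Proof.
rewrite !unfold_in => /asboolP [s ->]; apply/asboolP.
exists [seq existT (fun A => (mhom (MI A) G * MI A Y)%type) (projT1 p)
          ((projT2 p).1, mact (MI (projT1 p)) f (projT2 p).2) | p <- s].
rewrite big_map raddf_sum; apply: eq_bigr => p _ /=.
by rewrite -mapp_nat.
Qed.

Definition Tr_act X Y (f : hom X Y) (x : subgrp (@trace X)) : subgrp (@trace Y) :=
  SubGrp (trace_act f (sgvalP x)).

Fact Tr_act_is_additive X Y (f : hom X Y) : zmod_morphism (Tr_act f).
Proof. by move=> x y; apply/val_inj; rewrite /= raddfB. Qed.
HB.instance Definition _ X Y f :=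
  GRing.isZmodMorphism.Build _ _ (@Tr_act X Y f) (Tr_act_is_additive f).

Program Definition Tr : module C :=
  @Module C (fun X => subgrp (@trace X)) (fun X Y f => @Tr_act X Y f) _ _ _.
Next Obligation. by apply/val_inj; rewrite /= mact_id. Qed.
Next Obligation. by apply/val_inj; rewrite /= mact_comp. Qed.
Next Obligation. by apply/val_inj; rewrite /= mactD. Qed.

Program Definition Tr_incl : mhom Tr G := @MHom C Tr G (fun X x => sgval x) _ _.
Next Obligation. by []. Qed.

End Trace.

Definition Ann (F : module C) : Prop :=
  forall A B (f : hom A B), f \in I A B -> forall x, mact F f x = 0.

(** The inverse of [pi_mod] on modules annihilated by I. *)
Section Omega.
Variables (F : module C) (annF : Ann F).

Lemma mact_repr A B (f : hom A B) x : mact F (repr (qproj f)) x = mact F f x.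
Proof.
by apply/eqP; rewrite -subr_eq0 -mactB annF //; apply: quot_repr.
Qed.

Program Definition Omega : module quot_cat :=
  @Module quot_cat F (fun A B (f : qhom A B) => mact F (repr f)) _ _ _.
Next Obligation. by rewrite mact_repr mact_id. Qed.
Next Obligation. by rewrite mact_repr mact_comp. Qed.
Next Obligation.
by rewrite -[f in LHS]qproj_repr -[g in LHS]qproj_repr -qprojD mact_repr mactD.
Qed.

End Omega.

Program Definition Omega_map (F F' : module C) (annF : Ann F) (annF' : Ann F')
    (t : mhom F F') : mhom (Omega annF) (Omega annF') :=
  @MHom quot_cat (Omega annF) (Omega annF') (fun A x => t A x) _ _.
Next Obligation. exact: mapp_additive. Qed.
Next Obligation. exact: mapp_nat. Qed.

Lemma Ann_MI (A : C) : Ann (MI A).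
Proof.
move=> X Y f fI h; rewrite /= /MI_act.
have -> : qpi f = 0 by apply: (addrI (qpi 0)); rewrite -qpiD addr0 add0r;
  apply/qprojP; rewrite subr0.
by apply: (addrI (0 \oc h)); rewrite -comp_addl !addr0.
Qed.

Lemma Ann_Tr (G : module C) : Ann (Tr G).
Proof.
move=> A B f fI [x xT]; apply/val_inj => /=.
move: xT; rewrite unfold_in => /asboolP [s ->].
rewrite raddf_sum; apply: big1 => p _.
by rewrite -mapp_nat Ann_MI // raddf0.
Qed.

Fact trace_map (G H : module C) (t : mhom G H) X x :
  x \in @trace G X -> t X x \in @trace H X.
Proof.
rewrite !unfold_in => /asboolP [s ->]; apply/asboolP.
exists [seq existT (fun A => (mhom (MI A) H * MI A X)%type) (projT1 p)
          (t \om (projT2 p).1, (projT2 p).2) | p <- s].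
by rewrite big_map raddf_sum.
Qed.

Program Definition Tr_map (G H : module C) (t : mhom G H) : mhom (Tr G) (Tr H) :=
  @MHom C (Tr G) (Tr H) (fun X x => SubGrp (trace_map t (sgvalP x))) _ _.
Next Obligation. by move=> x y; apply/val_inj; rewrite /= raddfB. Qed.
Next Obligation. by apply/val_inj; rewrite /= mapp_nat. Qed.

Definition TrB (G : module C) : module quot_cat := Omega (@Ann_Tr G).

Definition TrB_map (G H : module C) (t : mhom G H) : mhom (TrB G) (TrB H) :=
  Omega_map (@Ann_Tr G) (@Ann_Tr H) (Tr_map t).

Program Definition TrB_cx (X : complex C) : complex quot_cat :=
  @Complex quot_cat (fun n => TrB (X n)) (fun n => TrB_map (cxd X n)) _.
Next Obligation.
by apply: mhomP => A x; apply/val_inj; rewrite /= cxd2E.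
Qed.

Program Definition TrB_aug (G : module C) (X : aug_complex G) :
    aug_complex (TrB G) :=
  @AugComplex quot_cat (TrB G) (TrB_cx X) (TrB_map (aug X)) _.
Next Obligation.
by apply: mhomP => A x; apply/val_inj; rewrite /= aug_dE.
Qed.

(** The counit pi_* TrB G = Tr G -> G *)
Program Definition counit (G : module C) : mhom (pi_mod (TrB G)) G :=
  @MHom C (pi_mod (TrB G)) G (fun X => Tr_incl G X) _ _.
Next Obligation. by []. Qed.
Next Obligation.
exact: (congr1 (@sgval _ _) (mact_repr (@Ann_Tr G) f x)).
Qed.

(** The canonical morphism phi^i : Ext^i(F, TrB G) -> Ext^i(pi_* F, G).  The
    groups are computed with the coresolutions [J] of TrB G, [K] of pi_* TrB G
    and [L] of G; [u] and [v] are to lift the identity and the counit. *)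
Definition phi (i : nat) (F : module quot_cat) (G : module C)
    (J : inj_coresolution (TrB G)) (K : inj_coresolution (pi_mod (TrB G)))
    (L : inj_coresolution G) (u : complex_map (pi_cx J) K)
    (v : complex_map K L) : Ext i F J -> Ext i (pi_mod F) L :=
  Ext_map i (pi_mod F) v \o pi_Ext i F u.

End QuotientCategory.

Arguments phi {C I} i F {G J K L} u v.

(* Main.v *)
From HB Require Import structures.
From mathcomp Require Import all_boot all_algebra.
From mathcomp Require Import boolp classical_sets functions.
Require Import Defs.

Set Implicit Arguments.
Unset Strict Implicit.
Unset Printing Implicit Defensive.

Import GRing.Theory Num.Theory.
Local Open Scope ring_scope.
Local Open Scope quotient_scope.

(** Everything rests on the adjunction between [pi_mod] and [TrB].  An element
    of M lies in the trace exactly when I kills it ([traceP]): it is then the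
    image of the class of the identity under some M_A -> M.  Hence a morphism
    pi_* F -> M takes its values in the trace, and Hom(pi_* F, M) is
    Hom(F, TrB M).  As [pi_mod] is exact, [TrB] preserves injectives and is left
    exact, so that condition (a) only asks that TrB E be exact in degrees
    1, ..., k ([TrB_begins]).  By the same description of the trace,
    Hom(M_A, -) is the value of [TrB] at A, and (b) says the same about every
    injective coresolution of G ([EXT_zero_TrB]); homotopy invariance makes one
    coresolution as good as another ([EXT_zero_indep]).

    For (c), let w : J -> TrB L be the transpose of v \o u under the adjunction.
    It is a map of complexes under TrB G, and phi^i becomes the map that w
    induces from H^i(Hom(F, J)) to H^i(Hom(F, TrB L)) ([adjoint_phi_cocycle]).
    If TrB L begins an injective coresolution, the mapping cone of w is exact
    with injective terms as far as degree k matters, Hom(F, -) keeps it exact,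
    and phi^i is bijective ([phi_bijective]).  Conversely, take F = Hom(A, -):
    then Hom(F, J) = J(A) is exact, so surjectivity of phi^i forces the i-th
    cohomology of TrB L at A to vanish ([phi_rep_exact]).

    The converse needs coresolutions of TrB G and of pi_* TrB G to which (c) can
    be applied.  They come from enough injectives in Mod(C): the modules
    Hom_Z(C(-, A), Q/Z) are injective because characters extend, and a module
    embeds into the product of these over all characters of its values. *)
(** * Characters with values in Q/Z *)

Definition divisible (T : zmodType) : Prop :=
  forall (n : nat) (t : T), exists t' : T, t' *+ n.+1 = t.

Section ExtendGraph.
Variables (V T : zmodType) (divT : divisible T).

(** A partial additive function, as the set of its pairs.  Non-emptiness is left
    out so that the empty union satisfies the hypothesis of Zorn's lemma. *)
Definition additive_graph (R : set (V * T)) : Prop :=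
  (forall x y, R x -> R y -> R (x - y)) /\ (forall t, R (0, t) -> t = 0).

Section AdditiveGraph.
Variables (R : set (V * T)) (gR : additive_graph R).

Lemma graph0 x : R x -> R 0.
Proof. by move=> Rx; rewrite -(subrr x); apply: gR.1. Qed.

Lemma graphN x : R x -> R (- x).
Proof. by move=> Rx; rewrite -sub0r; apply: gR.1 => //; apply: graph0 Rx. Qed.

Lemma graphMn x n : R x -> R (x *+ n).
Proof.
move=> Rx; elim: n => [|n IH]; first by rewrite mulr0n; apply: graph0 Rx.
by rewrite mulrSr -[x in _ + x]opprK; apply: gR.1 => //; apply: graphN.
Qed.

Lemma graph_inj v s t : R (v, s) -> R (v, t) -> s = t.
Proof.
move=> Rs Rt; apply/eqP; rewrite -subr_eq0; apply/eqP/gR.2.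
by have : R (v - v, s - t) := gR.1 _ _ Rs Rt; rewrite subrr.
Qed.

(** A value at [v] compatible with the values already imposed on the multiples
    of [v].  If some positive multiple lies in the domain, let [m] be the least
    one: dividing its value by [m] works, since by division with remainder every
    multiple in the domain is a multiple of [m v]. *)
Lemma graph_value v : exists t, forall n s, R (v *+ n, s) -> s = t *+ n.
Proof.
pose dom n := `[< (0 < n)%N /\ exists s, R (v *+ n, s) >].
have [[n0 dom_n0]|no_dom] := pselect (exists n, dom n); last first.
  exists 0 => -[|n] s Rs; first by apply: gR.2; move: Rs; rewrite mulr0n.
  by case: no_dom; exists n.+1; apply/asboolP; split=> //; exists s.
have [m1 /asboolP [m1_gt0 [s0 Rs0]] m_min] :=
  ex_minnP (ex_intro (fun n => is_true (dom n)) n0 dom_n0).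
case: m1 m1_gt0 Rs0 m_min => // m _ Rs0 m_min.
have [t t_s0] := divT m s0; exists t => n s Rs.
have Rq : R (v *+ (n %/ m.+1 * m.+1), t *+ (n %/ m.+1 * m.+1)).
  have := graphMn (n %/ m.+1) Rs0.
  by rewrite mulnC !mulrnA t_s0 !pairMnE.
have := gR.1 _ _ Rs Rq.
rewrite [in X in X - _](divn_eq n m.+1).
have -> : (v *+ (n %/ m.+1 * m.+1 + n %% m.+1), s) -
    (v *+ (n %/ m.+1 * m.+1), t *+ (n %/ m.+1 * m.+1)) =
    (v *+ (n %% m.+1), s - t *+ (n %/ m.+1 * m.+1)) :> V * T.
  by congr (_, _); rewrite /= mulrnDr addrC addKr.
have := ltn_pmod n (ltn0Sn m); rewrite [in t *+ n](divn_eq n m.+1).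
case: (n %% m.+1)%N => [_|r r_lt] Rr.
  by rewrite addn0; apply/eqP; rewrite -subr_eq0; apply/eqP/gR.2.
suff /m_min : dom r.+1 by rewrite leqNgt r_lt.
by apply/asboolP; split=> //; exists (s - t *+ (n %/ m.+1 * m.+1)).
Qed.

End AdditiveGraph.

(** Zorn's lemma gives a maximal partial function above [R]; by [graph_value] it
    could be extended to any element missing from its domain, so it is total. *)
Lemma extend_graph (R : set (V * T)) : R 0 -> additive_graph R ->
  exists g : {additive V -> T}, forall v t, R (v, t) -> g v = t.
Proof.
move=> R0 gR.
(* Containing [R] is only asked of nonempty sets: the empty chain has an empty
   union. *)
pose P A := additive_graph A /\ forall x, A x -> subset R A.
have [F FP Ftot|A [[gA RA] Amax]] := Zorn_bigcup (P := P).
  have pick2 x y : (\bigcup_(X in F) X)%classic x ->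
      (\bigcup_(X in F) X)%classic y ->
      exists2 X, F X & X x /\ X y.
    move=> [X FX Xx] [Y FY Yy].
    have [XY|YX] := Ftot _ _ FX FY.
      by exists Y => //; split=> //; apply: XY.
    by exists X => //; split=> //; apply: YX.
  split; first split.
  - move=> x y Fx Fy; have [X FX [Xx Xy]] := pick2 _ _ Fx Fy.
    by exists X => //; apply: (FP _ FX).1.1.
  - by move=> t [X FX Xt]; apply: (FP _ FX).1.2.
  by move=> x [X FX Xx] y Ry; exists X => //; apply: (FP _ FX).2 Xx _ Ry.
have A0 : A 0.
  apply: contrapT => nA0; apply: (Amax R).
    by split=> [x Ax|RA0]; [case: nA0; apply: (RA x) | apply/nA0/RA0].
  exact: (conj gR (fun _ _ => @subset_refl _ R)).
have {}RA : subset R A := RA _ A0.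
have graph_total v : exists t, A (v, t).
  have [t tP] := graph_value gA v.
  pose B : set (V * T) := fun y => exists x z, A x /\ y = x + (v, t) *~ z.
  have AB : subset A B by move=> x Ax; exists x, 0; rewrite mulr0z addr0.
  have Bvt : B (v, t) by exists 0, 1; rewrite add0r.
  suff PB : P B.
    exists t; apply: contrapT => nA; case: (Amax B _ PB).
    by split=> // BA; apply/nA/BA.
  split; last by move=> _ _ x /RA/AB.
  split.
    move=> _ _ [x [z [Ax ->]]] [x' [z' [Ax' ->]]]; exists (x - x'), (z - z').
    by split; [apply: gA.1 | rewrite mulrzBr opprD addrACA].
  move=> s [x [z [Ax Es]]].
  have {Ax}: A ((0, s) - (v, t) *~ z) by rewrite Es addrK.
  case: z {Es} => n => [|]; rewrite ?NegzE ?mulrNz ?opprK -pmulrn pairMnE => Ax.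
    have := graphN gA Ax.
    have -> : - ((0, s) - (v *+ n, t *+ n)) = (v *+ n, t *+ n - s) :> V * T.
      by rewrite opprB; congr (_, _); rewrite /= subr0.
    move/tP => E; apply: oppr_inj; apply: (addrI (t *+ n)).
    by rewrite E oppr0 addr0.
  move: Ax.
  have -> : ((0, s) + (v *+ n.+1, t *+ n.+1)) =
      (v *+ n.+1, s + t *+ n.+1) :> V * T.
    by congr (_, _); rewrite /= add0r.
  by move/tP => E; apply: (addIr (t *+ n.+1)); rewrite E add0r.
pose g v := sval (cid (graph_total v)).
have gP v : A (v, g v) by rewrite /g; case: cid.
have g_add : zmod_morphism g.
  by move=> x y; apply: (graph_inj gA (gP _)); apply: (gA.1 (x, _) (y, _)).
pose gA' := GRing.isZmodMorphism.Build V T g g_add.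
pose gadd : {additive V -> T} := HB.pack g gA'.
exists gadd => v t /RA Avt; exact: (graph_inj gA (gP v) Avt).
Qed.

End ExtendGraph.

Definition rat_integer : {pred rat} := fun x => x \is a Num.int.

Fact rat_integer_closed : zmod_closed rat_integer.
Proof. by split=> [|x y]; rewrite !unfold_in; [apply: rpred0 | apply: rpredB]. Qed.
HB.instance Definition _ := 
  GRing.isZmodClosed.Build rat rat_integer rat_integer_closed.

Definition QmodZ : zmodType := Quotient.quot rat_integer.

Lemma quot_piMn (V : zmodType) (S : zmodClosed V) (x : V) n :
  \pi_(Quotient.quot S) (x *+ n) = \pi_(Quotient.quot S) x *+ n.
Proof.
elim: n => [|n IH]; last by rewrite !mulrS quot_piD IH.
by rewrite !mulr0n !piE.
Qed.

Lemma QmodZ_divisible : divisible QmodZ.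
Proof.
move=> n t; exists (\pi_(Quotient.quot rat_integer)
  (repr (t : Quotient.quot rat_integer) / n.+1%:R)).
rewrite -quot_piMn -(mulr_natr (_ / _)) divfK ?pnatr_eq0 //.
exact: reprK.
Qed.

Lemma QmodZ_torsion n : exists2 t : QmodZ, t != 0 & t *+ n.+2 = 0.
Proof.
exists (\pi_(Quotient.quot rat_integer) (n.+2%:R^-1)).
  apply/eqP; have -> : 0 = \pi_(Quotient.quot rat_integer) 0 by rewrite !piE.
  move/quot_eqP; rewrite subr0 unfold_in => /intrP [m].
  move/(congr1 ( *%R n.+2%:R)); rewrite mulfV ?pnatr_eq0 // => E.
  have : (1 = n.+2%:Z * m)%R by apply/eqP; rewrite -(eqr_int rat) intrM -E.
  by case: m {E} => [[|m]|m] //; rewrite mulrC.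
rewrite -quot_piMn -(mulr_natr (_ ^-1)) mulVf ?pnatr_eq0 //.
have -> : 0 = \pi_(Quotient.quot rat_integer) 0 by rewrite !piE.
by apply/quot_eqP; rewrite subr0 unfold_in; apply: rpred1.
Qed.

(** It suffices to map the cyclic group generated by [x] to Q/Z with [x] going
    to a nonzero element: one of order 2 if [x] has infinite order, and
    otherwise one that the order of [x] kills. *)
Lemma character_separates (V : zmodType) (x : V) : x != 0 ->
  exists chi : {additive V -> QmodZ}, chi x != 0.
Proof.
move=> x0.
have [t t0 tP] : exists2 t : QmodZ, t != 0 & forall n, x *+ n = 0 -> t *+ n = 0.
  have [tors|free] := pselect (exists n, x *+ n.+1 = 0); last first.
    have [t t0 _] := QmodZ_torsion 0; exists t => // -[|n] xn //.
    by case: free; exists n.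
  have /ex_minnP[m] : exists n, x *+ n.+1 == 0.
    by case: tors => n /eqP; exists n.
  case: m => [|m] /eqP xm m_min.
    by rewrite mulr1n in xm; rewrite xm eqxx in x0.
  have [t t0 tm] := QmodZ_torsion m; exists t => // n.
  rewrite (divn_eq n m.+2) !mulrnDr mulnC !mulrnA xm tm !mul0rn !add0r.
  have := ltn_pmod n (ltn0Sn m.+1); case: (n %% m.+2)%N => // r r_lt /eqP/m_min.
  by rewrite leqNgt -ltnS r_lt.
pose R : set (V * QmodZ) := fun y => exists z : int, y = (x, t) *~ z.
have [||chi chiP] := extend_graph QmodZ_divisible (R := R).
- by exists 0; rewrite mulr0z.
- split=> [_ _ [z ->] [z' ->]|s [z]]; first by exists (z - z'); rewrite mulrzBr.
  case: z => n; rewrite ?NegzE ?mulrNz -pmulrn pairMnE /= => -[].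
    by move=> /esym/tP -> ->.
  by move=> /esym/eqP; rewrite oppr_eq0 => /eqP/tP -> ->; rewrite oppr0.
by exists chi; rewrite (chiP x t) //; exists 1.
Qed.

Lemma character_extends (U V : zmodType) (i : {additive U -> V})
    (chi : {additive U -> QmodZ}) : injective i ->
  exists psi : {additive V -> QmodZ}, forall x, psi (i x) = chi x.
Proof.
move=> inj_i; pose R : set (V * QmodZ) := fun y => exists x, y = (i x, chi x).
have [||psi psiP] := extend_graph QmodZ_divisible (R := R).
- by exists 0; rewrite !raddf0.
- split=> [_ _ [x ->] [y ->]|t [x [ix ->]]]; first by
    exists (x - y); rewrite !raddfB.
  by have -> : x = 0; rewrite ?raddf0 //; apply: inj_i; rewrite raddf0.
by exists psi => x; apply: psiP; exists x.
Qed.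

(** * Images, cokernels and products of modules *)

Lemma mappB C (M N : module C) (t : mhom M N) A (x y : M A) :
  t A (x - y) = t A x - t A y.
Proof. exact: mapp_additive. Qed.

Lemma mapp0 C (M N : module C) (t : mhom M N) A : t A 0 = 0.
Proof. exact: raddf0. Qed.

Lemma mappN C (M N : module C) (t : mhom M N) A (x : M A) : t A (- x) = - t A x.
Proof. exact: raddfN. Qed.

Lemma mappD C (M N : module C) (t : mhom M N) A (x y : M A) :
  t A (x + y) = t A x + t A y.
Proof. exact: raddfD. Qed.

Lemma mono_ker0 C (M N : module C) (t : mhom M N) :
  (forall A x, t A x = 0 -> x = 0) -> mono t.
Proof.
move=> t0 A x y txy; apply/eqP; rewrite -subr_eq0; apply/eqP/t0.
by rewrite mappB txy subrr.
Qed.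

Lemma mono_eq0 C (M N : module C) (t : mhom M N) A (x : M A) :
  mono t -> t A x = 0 -> x = 0.
Proof. by move=> inj_t tx; apply: (inj_t A); rewrite mapp0. Qed.

Lemma mcompE C (M N P : module C) (s : mhom M N) (t : mhom N P) f :
  t \om s = f -> forall A x, t A (s A x) = f A x.
Proof. by move=> <-. Qed.

Section ImageCokernel.
Variables (C : preadditive) (M N : module C) (t : mhom M N).

Definition im_pred (A : C) : {pred N A} := fun y => `[< exists x, t A x = y >].

Fact im_pred_closed A : zmod_closed (@im_pred A).
Proof.
split=> [|y y']; rewrite !unfold_in.
  by apply/asboolP; exists 0; rewrite mapp0.
move=> /asboolP[x <-] /asboolP[x' <-]; apply/asboolP; exists (x - x').
by rewrite mappB.
Qed.
HB.instance Definition _ A :=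
  GRing.isZmodClosed.Build (N A) (@im_pred A) (im_pred_closed A).

Lemma im_predP A y : reflect (exists x, t A x = y) (y \in @im_pred A).
Proof. exact: asboolP. Qed.

Lemma im_pred_act A B (f : hom A B) y :
  y \in @im_pred A -> mact N f y \in @im_pred B.
Proof.
by move=> /im_predP[x <-]; apply/im_predP; exists (mact M f x); rewrite mapp_nat.
Qed.

Definition mimage_act A B (f : hom A B) (y : subgrp (@im_pred A)) :
  subgrp (@im_pred B) := SubGrp (im_pred_act f (sgvalP y)).

Fact mimage_act_is_additive A B (f : hom A B) : zmod_morphism (mimage_act f).
Proof. by move=> x y; apply/val_inj; rewrite /= raddfB. Qed.
HB.instance Definition _ A B f :=
  GRing.isZmodMorphism.Build _ _ (@mimage_act A B f) (mimage_act_is_additive f).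

Program Definition mimage : module C :=
  @Module C (fun A => subgrp (@im_pred A)) (fun A B f => @mimage_act A B f) _ _ _.
Next Obligation. by apply/val_inj; rewrite /= mact_id. Qed.
Next Obligation. by apply/val_inj; rewrite /= mact_comp. Qed.
Next Obligation. by apply/val_inj; rewrite /= mactD. Qed.

Program Definition mimage_incl : mhom mimage N :=
  @MHom C mimage N (fun A y => sgval y) _ _.
Next Obligation. by []. Qed.

(** An injective module extends morphisms along arbitrary morphisms, provided
    the obvious obstruction vanishes: [f] descends to the image of [t]. *)
Lemma factor_through (E : module C) (f : mhom M E) : injective_module E ->
  (forall A x, t A x = 0 -> f A x = 0) -> exists g : mhom N E, g \om t = f.
Proof.
move=> injE f0.
have pre A (y : mimage A) : exists x, t A x = sgval y :=
  elimT (im_predP _) (sgvalP y).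
pose p A y := sval (cid (pre A y)).
have pP A y : t A (p A y) = sgval y := svalP (cid (pre A y)).
have fE A x x' : t A x = t A x' -> f A x = f A x'.
  move=> txx'; apply/eqP; rewrite -subr_eq0 -mappB; apply/eqP/f0.
  by rewrite mappB txx' subrr.
have add A : zmod_morphism (fun y : mimage A => f A (p A y)).
  by move=> x y; rewrite -mappB; apply: fE; rewrite mappB !pP.
have nat A B (h : hom A B) (y : mimage A) :
    f B (p B (mact mimage h y)) = mact E h (f A (p A y)).
  by rewrite -mapp_nat; apply: fE; rewrite mapp_nat !pP.
have [|g gP] := injE mimage N mimage_incl _ (MHom add nat).
  by move=> A x y; apply: val_inj.
exists g; apply: mhomP => A x.
have tx_im : t A x \in @im_pred A by apply/im_predP; exists x.
have /= := mcompE gP (SubGrp tx_im : mimage A).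
by rewrite /= => ->; apply: fE; rewrite pP.
Qed.

Definition coker_class A (y : N A) : Quotient.quot (@im_pred A) :=
  \pi_(Quotient.quot (@im_pred A)) y.

Lemma coker_class_repr A (q : Quotient.quot (@im_pred A)) :
  coker_class (repr q) = q.
Proof. exact: reprK. Qed.

Fact coker_class_is_additive A : zmod_morphism (@coker_class A).
Proof.
by move=> x y; apply/eqP; rewrite eq_sym subr_eq -[_ + _]quot_piD subrK.
Qed.
HB.instance Definition _ A :=
  GRing.isZmodMorphism.Build _ _ (@coker_class A) (@coker_class_is_additive A).

Definition coker_act A B (f : hom A B) (q : Quotient.quot (@im_pred A)) :
  Quotient.quot (@im_pred B) := coker_class (mact N f (repr q)).

Lemma coker_act_class A B (f : hom A B) y :
  coker_act f (coker_class y) = coker_class (mact N f y).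
Proof. by apply/quot_eqP; rewrite -raddfB; apply/im_pred_act/quot_repr. Qed.

Fact coker_act_is_additive A B (f : hom A B) : zmod_morphism (coker_act f).
Proof.
move=> p q; rewrite -[p]coker_class_repr -[q]coker_class_repr -raddfB.
by rewrite !coker_act_class !raddfB.
Qed.
HB.instance Definition _ A B f :=
  GRing.isZmodMorphism.Build _ _ (@coker_act A B f) (coker_act_is_additive f).

Program Definition mcoker : module C :=
  @Module C (fun A => Quotient.quot (@im_pred A)) (fun A B f => @coker_act A B f)
    _ _ _.
Next Obligation. by rewrite -[x]coker_class_repr coker_act_class mact_id. Qed.
Next Obligation. by rewrite -[x]coker_class_repr !coker_act_class mact_comp. Qed.
Next Obligation.
by rewrite -[x]coker_class_repr !coker_act_class mactD raddfD.
Qed.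

Program Definition coker_proj : mhom N mcoker :=
  @MHom C N mcoker (fun A y => coker_class y) _ _.
Next Obligation. exact: raddfB. Qed.
Next Obligation. by rewrite coker_act_class. Qed.

Lemma coker_proj_surj A (q : mcoker A) : exists y, coker_proj A y = q.
Proof. by exists (repr q); apply: coker_class_repr. Qed.

Lemma coker_proj_exact : exact_at t coker_proj.
Proof.
move=> A y; rewrite -[0](mapp0 coker_proj A).
split=> [/quot_eqP|yP]; first by rewrite subr0 => /im_predP.
by apply/quot_eqP; rewrite subr0; apply/im_predP.
Qed.

End ImageCokernel.

Section Product.
Variables (C : preadditive) (M N : module C).

Definition mprod_act A B (f : hom A B) (x : M A * N A) : M B * N B :=
  (mact M f x.1, mact N f x.2).

Fact mprod_act_is_additive A B (f : hom A B) : zmod_morphism (mprod_act f).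
Proof. by move=> x y; congr (_, _); rewrite /= raddfB. Qed.
HB.instance Definition _ A B f :=
  GRing.isZmodMorphism.Build _ _ (@mprod_act A B f) (mprod_act_is_additive f).

Program Definition mprod : module C :=
  @Module C (fun A => (M A * N A)%type) (fun A B f => @mprod_act A B f) _ _ _.
Next Obligation. by rewrite /mprod_act !mact_id. Qed.
Next Obligation. by rewrite /mprod_act !mact_comp. Qed.
Next Obligation. by rewrite /mprod_act !mactD. Qed.

Program Definition mpair P (s : mhom P M) (t : mhom P N) : mhom P mprod :=
  @MHom C P mprod (fun A x => (s A x, t A x)) _ _.
Next Obligation. by move=> x y; rewrite !mappB. Qed.
Next Obligation. by rewrite !mapp_nat. Qed.

Program Definition mfst : mhom mprod M := @MHom C mprod M (fun A x => x.1) _ _.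
Next Obligation. by []. Qed.

Program Definition msnd : mhom mprod N := @MHom C mprod N (fun A x => x.2) _ _.
Next Obligation. by []. Qed.

Lemma mprod_injective :
  injective_module M -> injective_module N -> injective_module mprod.
Proof.
move=> injM injN P Q i mono_i f.
have [g gP] := injM _ _ i mono_i (mfst \om f).
have [h hP] := injN _ _ i mono_i (msnd \om f).
exists (mpair g h); apply: mhomP => A x /=.
by rewrite (mcompE gP) (mcompE hP) [RHS]surjective_pairing.
Qed.

End Product.

(** * Enough injectives *)

(** The product over [p : K] of the modules Hom_Z(C(-, a p), Q/Z): its elements
    at [B] are the functions on all arrows from [B] to some [a p] that are
    additive for each fixed [p]. *)
Section Coinduced.
Variables (C : preadditive) (K : Type) (a : K -> C).

Definition arrow (B : C) : Type := {p : K & hom B (a p)}.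

Definition arr (B : C) p (f : hom B (a p)) : arrow B := existT _ p f.

Definition fibre_additive (B : C) : {pred arrow B -> QmodZ} := fun e =>
  `[< forall p (f g : hom B (a p)),
        e (arr (f - g)) = e (arr f) - e (arr g) >].

Fact fibre_additive_closed B : zmod_closed (@fibre_additive B).
Proof.
split=> [|e e']; rewrite !unfold_in.
  by apply/asboolP => p f g; rewrite subrr.
move=> /asboolP add /asboolP add'; apply/asboolP => p f g.
rewrite [LHS](congr2 (fun x y => x - y) (add p f g) (add' p f g)).
by rewrite opprD opprK addrACA opprD opprK.
Qed.
HB.instance Definition _ B := GRing.isZmodClosed.Build (arrow B -> QmodZ)
  (@fibre_additive B) (fibre_additive_closed B).

Definition coind_ob B : zmodType := subgrp (@fibre_additive B).

Lemma coind_additive B (e : coind_ob B) p (f g : hom B (a p)) :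
  sgval e (arr (f - g)) = sgval e (arr f) - sgval e (arr g).
Proof. exact: (elimT (asboolP _) (sgvalP e)). Qed.

Lemma coind_additiveD B (e : coind_ob B) p (f g : hom B (a p)) :
  sgval e (arr (f + g)) = sgval e (arr f) + sgval e (arr g).
Proof. by rewrite -{2}(addrK g f) coind_additive subrK. Qed.

Definition precomp A B (f : hom A B) (e : arrow A -> QmodZ) : arrow B -> QmodZ :=
  fun x => e (arr (projT2 x \oc f)).

Fact precomp_fibre_additive A B (f : hom A B) (e : coind_ob A) :
  precomp f (sgval e) \in @fibre_additive B.
Proof.
by apply/asboolP => p g h; rewrite /precomp /= comp_subl coind_additive.
Qed.

Definition coind_act A B (f : hom A B) (e : coind_ob A) : coind_ob B :=
  SubGrp (precomp_fibre_additive f e).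

Fact coind_act_is_additive A B (f : hom A B) : zmod_morphism (coind_act f).
Proof. by move=> e e'; apply/val_inj. Qed.
HB.instance Definition _ A B f :=
  GRing.isZmodMorphism.Build _ _ (@coind_act A B f) (coind_act_is_additive f).

Program Definition coind : module C :=
  @Module C coind_ob (fun A B f => @coind_act A B f) _ _ _.
Next Obligation.
by apply/val_inj/funext => -[p h]; rewrite /= /precomp /= comp_idr.
Qed.
Next Obligation.
by apply/val_inj/funext => -[p h]; rewrite /= /precomp /= comp_assoc.
Qed.
Next Obligation.
apply/val_inj/funext => -[p h]; rewrite /= /precomp /= comp_addr.
exact: coind_additiveD.
Qed.

(** A morphism from N to [coind] is the same as a character of N(a p) for each
    [p], namely its component at the identity of [a p]; so extending the
    morphism amounts to extending these characters. *)
Lemma coind_injective : injective_module coind.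
Proof.
move=> M N i mono_i f.
have psiP p : {psi : {additive N (a p) -> QmodZ} |
    forall x, psi (i (a p) x) = sgval (f (a p) x) (arr (idm (a p)))}.
  apply: cid.
  have chi_add : zmod_morphism
      (fun x : M (a p) => sgval (f (a p) x) (arr (idm (a p)))).
    by move=> x y; rewrite mappB.
  pose chi : {additive M (a p) -> QmodZ} :=
    HB.pack (fun x : M (a p) => sgval (f (a p) x) (arr (idm (a p))))
      (GRing.isZmodMorphism.Build _ _ _ chi_add).
  exact: (character_extends chi (mono_i (a p))).
pose psi p := sval (psiP p).
have g_fibre B (y : N B) :
    (fun x : arrow B => psi (projT1 x) (mact N (projT2 x) y)) \in @fibre_additive B.
  by apply/asboolP => p h h' /=; rewrite mactB raddfB.
have g_add B : zmod_morphism (fun y => SubGrp (g_fibre B y) : coind B).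
  by move=> x y; apply/val_inj/funext => z /=; rewrite !raddfB.
have g_nat A B (h : hom A B) y :
    SubGrp (g_fibre B (mact N h y)) = mact coind h (SubGrp (g_fibre A y)).
  by apply/val_inj/funext => z /=; rewrite /precomp /= mact_comp.
exists (@MHom C N coind (fun A y => SubGrp (g_fibre A y)) g_add g_nat).
apply: mhomP => B x; apply/val_inj/funext => -[p h] /=.
by rewrite -mapp_nat (svalP (psiP p)) mapp_nat /= /precomp /= comp_idl.
Qed.

End Coinduced.

Section InjectiveHull.
Variables (C : preadditive) (M : module C).

Definition character : Type := {A : C & {additive M A -> QmodZ}}.

(** The family consists of all characters of all the groups M(A), each placed at
    its object A, so that every nonzero element is detected. *)
Definition inj_env : module C := coind (fun p : character => projT1 p).

Definition ev_chars A (y : M A) :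
    arrow (fun p : character => projT1 p) A -> QmodZ :=
  fun x => projT2 (projT1 x) (mact M (projT2 x) y).

Fact ev_chars_fibre_additive A (y : M A) : ev_chars y \in fibre_additive (B := A).
Proof. by apply/asboolP => p f g; rewrite /ev_chars /= mactB raddfB. Qed.

Program Definition inj_emb : mhom M inj_env :=
  @MHom C M inj_env (fun A y => SubGrp (ev_chars_fibre_additive y)) _ _.
Next Obligation.
by move=> x y; apply/val_inj/funext => z; rewrite /= /ev_chars !raddfB.
Qed.
Next Obligation.
by apply/val_inj/funext => z; rewrite /= /ev_chars /precomp /= mact_comp.
Qed.

Lemma inj_emb_mono : mono inj_emb.
Proof.
apply: mono_ker0 => A x /(congr1 (@sgval _ _)) x0.
apply/eqP/negP => /negP/character_separates[chi /eqP[]].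
have : ev_chars x (@arr _ _ (fun p : character => projT1 p) A
  (existT _ A chi : character) (idm A)) = 0 by move: x0 => /= ->.
by rewrite /ev_chars /= mact_id.
Qed.

End InjectiveHull.

Section EnoughInjectives.
Variables (C : preadditive) (G : module C).

(** The coresolution is spliced from 0 -> Z_n -> env(Z_n) -> Z_(n+1) -> 0 with
    Z_0 = G. *)
Fixpoint cosyzygy n : module C :=
  if n is m.+1 then mcoker (inj_emb (cosyzygy m)) else G.

Definition res_d n : mhom (inj_env (cosyzygy n)) (inj_env (cosyzygy n.+1)) :=
  inj_emb (cosyzygy n.+1) \om coker_proj (inj_emb (cosyzygy n)).

Lemma res_d_ker n A y :
  res_d n A y = 0 <-> exists x, inj_emb (cosyzygy n) A x = y.
Proof.
split=> [dy|/coker_proj_exact yE].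
  by apply/coker_proj_exact/(mono_eq0 (@inj_emb_mono _ _) dy).
by rewrite -(mapp0 (inj_emb (cosyzygy n.+1)) A) -yE.
Qed.

Program Definition res_cx : complex C :=
  @Complex C (fun n => inj_env (cosyzygy n)) res_d _.
Next Obligation.
by apply: mhomP => A x; apply: (proj2 (@res_d_ker n.+1 A _)); eexists.
Qed.

Program Definition res_aug : aug_complex G :=
  @AugComplex C G res_cx (inj_emb G) _.
Next Obligation.
by apply: mhomP => A x; apply: (proj2 (@res_d_ker 0 A _)); exists x.
Qed.

Lemma res_augP : begins_injective_coresolution None res_aug.
Proof.
split=> [n _||A y|n _ A y].
- exact: coind_injective.
- exact: inj_emb_mono.
- exact: (@res_d_ker 0).
split=> [/res_d_ker[x <-]|[x <-]]; last by apply: cxd2E.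
have [y' <-] := @coker_proj_surj _ _ _ _ _ x.
by exists y'.
Qed.

Definition inj_res : inj_coresolution G := InjCoresolution res_augP.

End EnoughInjectives.

(** * The comparison theorem *)

Section Comparison.
Variables (C : preadditive) (X Y : complex C).
Hypothesis exX : forall n, exact_at (cxd X n) (cxd X n.+1).
Hypothesis injY : forall n, injective_module (Y n).

(** A morphism of complexes is built degree by degree; the recursion carries two
    consecutive components together with their commutation, which is what
    determines the next component. *)
Record square (n : nat) := Square {
  sq_src : mhom (X n) (Y n);
  sq_tgt : mhom (X n.+1) (Y n.+1);
  sq_comm : sq_tgt \om cxd X n = cxd Y n \om sq_src }.

(** The composite d \om [sq_tgt s] kills the image of d, which is the kernel of
    the next differential. *)
Fact next_square_exists n (s : square n) :
  {t : mhom (X n.+2) (Y n.+2) | t \om cxd X n.+1 = cxd Y n.+1 \om sq_tgt s}.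
Proof.
apply: cid; apply: factor_through => [|A x /exX[y <-]]; first exact: injY.
by rewrite /= (mcompE (sq_comm s)) /= cxd2E.
Qed.

Definition next_square n (s : square n) : square n.+1 :=
  Square (svalP (next_square_exists s)).

Fixpoint squares (s0 : square 0) n : square n :=
  if n is m.+1 then next_square (squares s0 m) else s0.

Definition squares_map (s0 : square 0) : complex_map X Y :=
  @ComplexMap C X Y (fun n => sq_src (squares s0 n))
    (fun n => sq_comm (squares s0 n)).

End Comparison.

Lemma comparison C (M N : module C) (X : aug_complex M) (Y : aug_complex N)
    (g : mhom M N) :
  mono (aug X) -> exact_at (aug X) (cxd X 0) ->
  (forall n, exact_at (cxd X n) (cxd X n.+1)) ->
  (forall n, injective_module (Y n)) ->
  exists u : complex_map X Y, lifts g X Y u.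
Proof.
move=> monoX exX0 exX injY.
have [u0 u0P] := injY _ _ _ _ monoX (aug Y \om g).
have [|A x /exX0[y <-]|u1 u1P] :=
    @factor_through _ _ _ (cxd X 0) (Y 1) (cxd Y 0 \om u0); first exact: injY.
  by rewrite /= (mcompE u0P) /= aug_dE.
by exists (squares_map exX injY (Square u1P)).
Qed.

(** * Exact complexes of injectives and mapping cones *)

Section SplitExact.
Variables (C : preadditive) (Z : complex C) (n : nat).
Hypothesis injZ : forall m, (m <= n)%N -> injective_module (Z m).
Hypothesis monoZ : mono (cxd Z 0).
Hypothesis exZ : forall m, (m <= n)%N -> exact_at (cxd Z m) (cxd Z m.+1).

(** One half of a contraction, which is all that exactness of Hom(F, -) takes.
    From d h d = d one gets (1 - d h) d = 0, so 1 - d h factors through the next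
    differential as h' d', and then d' h' d' = d' (1 - d h) = d'. *)
Lemma quasi_inverse m : (m <= n)%N ->
  exists h : mhom (Z m.+1) (Z m), cxd Z m \om (h \om cxd Z m) = cxd Z m.
Proof.
elim: m => [_|m IH lt_mn].
  have [h hP] := injZ (leq0n n) monoZ (mid (Z 0%N)).
  by exists h; apply: mhomP => A x /=; rewrite (mcompE hP).
have [h hP] := IH (ltnW lt_mn).
have [|A x /(exZ (ltnW lt_mn))[y <-]|h' h'P] :=
    @factor_through _ _ _ (cxd Z m.+1) _ (mid (Z m.+1) - cxd Z m \om h).
- exact: injZ.
- by rewrite mhomBE /= (mcompE hP) subrr.
exists h'; apply: mhomP => A x.
by rewrite /= (mcompE h'P) mhomBE mappB /= cxd2E subr0.
Qed.

(** A cocycle [s] has its values in the image of d, on which d h is the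
    identity. *)
Lemma hom_exact (F : module C) (s : mhom F (Z n.+1)) :
  cxd Z n.+1 \om s = 0 -> exists s', s = cxd Z n \om s'.
Proof.
move=> ds; have [h hP] := quasi_inverse (leqnn n).
exists (h \om s); apply: mhomP => A x /=.
have [y <-] := proj1 (exZ (leqnn n) (s A x)) (mcompE ds x).
exact/esym/(mcompE hP).
Qed.

End SplitExact.

Section Cone.
Variables (C : preadditive) (X Y : complex C) (w : complex_map X Y).

(** The mapping cone of [w], shifted so that X_0 sits in degree 0. *)
Definition cone_ob n : module C := if n is m.+1 then mprod (X m.+1) (Y m) else X 0.

Definition cone_d n : mhom (cone_ob n) (cone_ob n.+1) :=
  match n with
  | 0 => mpair (- cxd X 0) (w 0)
  | m.+1 => mpair (- (cxd X m.+1 \om mfst _ _))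
                  (w m.+1 \om mfst _ _ + cxd Y m \om msnd _ _)
  end.

Program Definition cone : complex C := @Complex C cone_ob cone_d _.
Next Obligation.
apply: mhomP => A; case: n => [x|n [x y]]; congr (_, _).
- by rewrite /= mappN cxd2E !oppr0.
- by rewrite /= mappN cxmap_commE addNr.
- by rewrite /= mappN cxd2E !oppr0.
by rewrite /= mappN mappD cxd2E addr0 cxmap_commE addNr.
Qed.

End Cone.

Lemma le_oo_trans m n k : (m <= n)%N -> le_oo n k -> le_oo m k.
Proof. by case: k => //= j; apply: leq_trans. Qed.

Section HomologyComparison.
Variables (C : preadditive) (G : module C) (X Y : aug_complex G) (k : option nat).
Variable w : complex_map X Y.
Hypothesis resX : begins_injective_coresolution None X.
Hypothesis resY : begins_injective_coresolution k Y.
Hypothesis w_lifts : lifts (mid G) X Y w.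

Lemma cone_injective n : le_oo n k -> injective_module (cone w n.+1).
Proof.
have [[injX _ _ _] [injY _ _ _]] := (resX, resY).
by move=> le_nk; apply: mprod_injective; [apply: injX | apply: injY].
Qed.

(** Both X and Y have kernel G in degree 0, and [w] is the identity there. *)
Lemma cone_mono : mono (cxd (cone w) 0).
Proof.
have [[_ _ exX0 _] [_ monoY _ _]] := (resX, resY).
apply: mono_ker0 => A x [/eqP]; rewrite oppr_eq0 => /eqP /exX0[g <-].
by rewrite (mcompE w_lifts) /= => /(mono_eq0 monoY)->; rewrite mapp0.
Qed.

(** In the lowest degree, the first component of a cocycle is a boundary d x',
    and the remaining defect w x' + y lies in the kernel of d on Y_0, so it comes
    from G.  As G also embeds into X_0, x' can be corrected. *)
Lemma cone_exact n : le_oo n k -> exact_at (cxd (cone w) n) (cxd (cone w) n.+1).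
Proof.
have [[_ _ _ exX] [_ _ exY0 exY]] := (resX, resY).
move=> le_nk A [x y]; split=> [|[z <-]]; last exact: (cxd2E (X := cone w)).
case=> /eqP; rewrite oppr_eq0 => /eqP/(exX _ I)[x' <-].
rewrite cxmap_commE -mappD => wx'y.
case: n le_nk x y x' wx'y => [|n] le_nk x y x'.
  move/exY0 => [g gP]; exists (aug X A g - x'); congr (_, _).
    by rewrite /= mappB aug_dE sub0r opprK.
  by rewrite /= mappB (mcompE w_lifts) /= gP addrC addKr.
move/(exY _ le_nk) => [z zP]; exists (- x', z); congr (_, _).
  by rewrite /= mappN opprK.
by rewrite /= mappN zP addKr.
Qed.

Lemma cone_hom_exact (F : module C) n (s : mhom F (cone w n.+1)) :
  le_oo n k -> cxd (cone w) n.+1 \om s = 0 ->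
  exists s', s = cxd (cone w) n \om s'.
Proof.
move=> le_nk; apply: hom_exact => [[|m] le_mn||m le_mn].
- by have [injX _ _ _] := resX; apply: injX.
- by apply: cone_injective; apply: le_oo_trans (ltnW le_mn) le_nk.
- exact: cone_mono.
by apply: cone_exact; apply: le_oo_trans le_mn le_nk.
Qed.

(** The pair (x, - y) is a cocycle of the cone, hence a boundary.  The bound is
    on [n] because the cone in degree n + 1 involves Y_n but not Y_(n+1). *)
Lemma comparison_inj (F : module C) n (x : mhom F (X n.+1)) (y : mhom F (Y n)) :
  le_oo n k -> cxd X n.+1 \om x = 0 -> w n.+1 \om x = cxd Y n \om y ->
  exists x', x = cxd X n \om x'.
Proof.
move=> le_nk dx wx.
have [|z zP] := @cone_hom_exact F n
  (mpair x (- y) : mhom F (cone w n.+1)) le_nk.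
  apply: mhomP => A a; congr (_, _); rewrite /=.
    by rewrite (mcompE dx) oppr0.
  by rewrite (mcompE wx) /= mappN subrr.
have xE A a : (x A a, - y A a) = cxd (cone w) n A (z A a) :=
  esym (mcompE (esym zP) a).
case: n => [|n] in x y dx wx z zP le_nk xE *.
  exists (- z); apply: mhomP => A a; have [/= -> _] := xE A a.
  by rewrite /= mappN.
exists (- (mfst _ _ \om z)); apply: mhomP => A a; have [/= -> _] := xE A a.
by rewrite /= mappN.
Qed.

(** The pair (0, y) is a cocycle of the cone, hence a boundary. *)
Lemma comparison_surj (F : module C) n (y : mhom F (Y n.+1)) :
  le_oo n.+1 k -> cxd Y n.+1 \om y = 0 ->
  exists x : mhom F (X n.+1), exists z : mhom F (Y n),
    cxd X n.+1 \om x = 0 /\ y = w n.+1 \om x + cxd Y n \om z.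
Proof.
move=> le_nk dy.
have [|z zP] := @cone_hom_exact F n.+1 (mpair 0 y : mhom F (cone w n.+2)) le_nk.
  apply: mhomP => A a; congr (_, _); rewrite /=.
    by rewrite mapp0 oppr0.
  by rewrite mapp0 add0r (mcompE dy).
have yE A a : (0, y A a) = cxd (cone w) n.+1 A (z A a) :=
  esym (mcompE (esym zP) a).
exists (mfst _ _ \om z), (msnd _ _ \om z); split; apply: mhomP => A a.
  by have [/esym/eqP + _] := yE A a; rewrite oppr_eq0 => /eqP.
by have [_ ->] := yE A a.
Qed.

End HomologyComparison.

(** * The trace as a right adjoint *)

Section TraceAdjunction.
Variables (C : preadditive) (I : ideal C).

Lemma qprojB (A B : C) (f g : hom A B) : qproj I (f - g) = qproj I f - qproj I g.
Proof. by apply/eqP; rewrite eq_sym subr_eq -qprojD subrK. Qed.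

Lemma qpi_ideal (A B : C) (f : hom A B) : f \in isub I A B -> qpi I f = 0.
Proof.
by move=> fI; rewrite -(subrr (qpi I 0)) -qprojB;
   apply/qprojP; rewrite subrr subr0.
Qed.

Definition killed (M : module C) (A : C) (x : M A) : Prop :=
  forall B (f : hom A B), f \in isub I A B -> mact M f x = 0.

Lemma killed_eq (M : module C) (A : C) (x : M A) : killed x ->
  forall B (f g : hom A B), qproj I f = qproj I g -> mact M f x = mact M g x.
Proof.
by move=> kx B f g /qprojP/kx; rewrite mactB => /eqP; rewrite subr_eq0 => /eqP.
Qed.

(** An element killed by I determines a morphism from M_A by the Yoneda
    correspondence. *)
Section Elements.
Variables (M : module C) (A : C) (x : M A).
Hypothesis kx : killed x.

Program Definition elt_hom : mhom (MI I A) M :=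
  @MHom C (MI I A) M (fun B (h : qhom I A B) => mact M (repr h) x) _ _.
Next Obligation.
move=> h h'; rewrite -mactB; apply: (killed_eq kx).
by rewrite qprojB !qproj_repr.
Qed.
Next Obligation.
rewrite -mact_comp; apply: (killed_eq kx).
by rewrite -qcomp_proj !qproj_repr.
Qed.

Lemma elt_hom_id : elt_hom A (qproj I (idm A)) = x.
Proof.
by rewrite -[RHS](mact_id (m := M)); apply: (killed_eq kx); rewrite qproj_repr.
Qed.

End Elements.

Lemma traceP (M : module C) (A : C) (x : M A) :
  reflect (killed x) (x \in @trace C I M A).
Proof.
apply: (iffP idP) => [xT B f fI|kx].
  exact: (congr1 (@sgval _ _) (@Ann_Tr C I M A B f fI (SubGrp xT))).
apply/asboolP.
exists [:: existT (fun A' => (mhom (MI I A') M * MI I A' A)%type) A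
             (elt_hom kx, qproj I (idm A))].
rewrite big_seq1; exact: (esym (elt_hom_id kx)).
Qed.

Lemma MI_actE (A X : C) (h : MI I A X) :
  mact (MI I A) (repr (h : qhom I A X)) (qproj I (idm A)) = h.
Proof.
rewrite /= /MI_act /qpi qproj_repr; exact: (comp_idr (p := quot_cat I)).
Qed.

Lemma MI_hom_killed (A : C) (M : module C) (t : mhom (MI I A) M) X
    (h : MI I A X) :
  killed (t X h).
Proof. by move=> B f fI; rewrite -mapp_nat Ann_MI // mapp0. Qed.

Lemma MI_homE (A : C) (M : module C) (t : mhom (MI I A) M) X (h : MI I A X) :
  t X h = mact M (repr (h : qhom I A X)) (t A (qproj I (idm A))).
Proof. by rewrite -mapp_nat MI_actE. Qed.

Lemma sgval_TrB_act (M : module C) A B (f : @hom (quot_cat I) A B)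
    (x : TrB I M A) :
  sgval (mact (TrB I M) f x) = mact M (repr (f : qhom I A B)) (sgval x).
Proof. by []. Qed.

Section Adjoint.
Variables (F : module (quot_cat I)) (M : module C).

(** I acts by zero on pi_* F, hence on the image of [t]. *)
Fact pi_hom_trace (t : mhom (pi_mod F) M) A (x : F A) : t A x \in @trace C I M A.
Proof.
apply/traceP => B f fI; rewrite -mapp_nat.
have -> : mact (pi_mod F) f x = 0; last exact: mapp0.
rewrite /= qpi_ideal //; apply: (addrI (mact F 0 x)).
by rewrite -mactD !addr0.
Qed.

Program Definition adjoint (t : mhom (pi_mod F) M) : mhom F (TrB I M) :=
  @MHom (quot_cat I) F (TrB I M) (fun A x => SubGrp (pi_hom_trace t x)) _ _.
Next Obligation. by move=> x y; apply/val_inj; exact: mappB. Qed.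
Next Obligation.
apply/val_inj; rewrite [RHS]sgval_TrB_act /=.
rewrite -(mapp_nat t (repr (f : qhom I A B))) /=.
by congr (t _ (mact F _ _)); rewrite /qpi qproj_repr.
Qed.

Definition unadjoint (s : mhom F (TrB I M)) : mhom (pi_mod F) M :=
  counit I M \om pi_mhom s.

Lemma unadjointK s : adjoint (unadjoint s) = s.
Proof. by apply: mhomP => A x; apply/val_inj. Qed.

Lemma adjoint_inj t t' : adjoint t = adjoint t' -> t = t'.
Proof.
move=> E; apply: mhomP => A x.
exact: (congr1 (fun s : mhom F (TrB I M) => sgval (s A x)) E).
Qed.

Lemma adjoint0 : adjoint 0 = 0.
Proof. by apply: mhomP => A x; apply/val_inj. Qed.

End Adjoint.

Lemma adjoint_post F (M N : module C) (d : mhom M N) (t : mhom (pi_mod F) M) :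
  adjoint (d \om t) = TrB_map I d \om adjoint t.
Proof. by apply: mhomP => A x; apply/val_inj. Qed.

Lemma adjoint_pre F F' (M : module C) (t : mhom (pi_mod F) M) (s : mhom F' F) :
  adjoint (t \om pi_mhom s) = adjoint t \om s.
Proof. by apply: mhomP => A x; apply/val_inj. Qed.

Lemma adjointD F (M : module C) (t t' : mhom (pi_mod F) M) :
  adjoint (t + t') = adjoint t + adjoint t'.
Proof. by apply: mhomP => A x; apply/val_inj. Qed.

(** [TrB] is right adjoint to [pi_mod], which preserves monomorphisms. *)
Lemma TrB_injective (E : module C) : injective_module E -> injective_module (TrB I E).
Proof.
move=> injE M N i mono_i f.
have [//|g gP] := injE _ _ (pi_mhom i) _ (unadjoint f).
by exists (adjoint g); rewrite -adjoint_pre gP unadjointK.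
Qed.

Lemma TrB_mono (M N : module C) (t : mhom M N) : mono t -> mono (TrB_map I t).
Proof.
move=> mono_t A x y /(congr1 (@sgval _ _)) E.
exact/val_inj/(mono_t A).
Qed.

(** The preimage under a monomorphism of an element killed by I is killed
    by I. *)
Lemma TrB_left_exact (M N P : module C) (s : mhom M N) (t : mhom N P) :
  mono s -> exact_at s t -> exact_at (TrB_map I s) (TrB_map I t).
Proof.
move=> mono_s ex A y; split=> [/(congr1 (@sgval _ _)) ty|[x <-]].
  have [x xy] := proj1 (ex A (sgval y)) ty.
  have xT : x \in @trace C I M A.
    apply/traceP => B f fI; apply: (mono_eq0 mono_s).
    by rewrite mapp_nat xy; apply: (elimT (traceP _) (sgvalP y)).
  by exists (SubGrp xT); apply/val_inj.
by apply/val_inj/ex; exists (sgval x).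
Qed.

(** Injectivity of the terms and exactness at the start are automatic. *)
Lemma TrB_begins k (G : module C) (X : aug_complex G) :
  begins_injective_coresolution None X ->
  begins_injective_coresolution k (TrB_aug I X) <->
  forall n, le_oo n.+1 k ->
    exact_at (TrB_map I (cxd X n)) (TrB_map I (cxd X n.+1)).
Proof.
move=> [injX monoX exX0 _]; split=> [[_ _ _ ex]|ex]; first exact: ex.
split=> [n _|||n]; last exact: ex.
- exact/TrB_injective/injX.
- exact: TrB_mono.
exact: TrB_left_exact.
Qed.

End TraceAdjunction.
Arguments traceP {C I M A} x.

(** * Vanishing of EXT *)

Lemma coh_eq0 (X : cochain) n (x : subgrp (cocycle X n.+1)) :
  coh_class x = 0 <-> exists y, cdiff X n y = sgval x.
Proof.
have -> : 0 = coh_class (0 : subgrp (cocycle X n.+1)).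
  by apply: (addrI (coh_class 0)); rewrite -coh_classD !addr0.
split=> [/quot_eqP|xB].
  by rewrite subr0 unfold_in => /asboolP.
by apply/quot_eqP; rewrite subr0 unfold_in; apply/asboolP.
Qed.

Lemma coh_zero (X : cochain) n :
  (forall q : coh X n.+1, q = 0) <->
  (forall x, cdiff X n.+1 x = 0 -> exists y, cdiff X n y = x).
Proof.
split=> [coh0 x /eqP xZ|ex q].
  have [y yP] := proj1 (coh_eq0 (@SubGrp _ (cocycle X n.+1) x xZ)) (coh0 _).
  by exists y.
rewrite -[q]coh_class_repr; apply/coh_eq0/ex.
exact: (eqP (sgvalP (repr q))).
Qed.

Section ExtVanishing.
Variables (C : preadditive) (I : ideal C).

Lemma EXT_zero (G : module C) (J : inj_coresolution G) n :
  zero_module (EXT I n.+1 J) <->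
  forall A (t : mhom (MI I A) (J n.+1)), cxd J n.+1 \om t = 0 ->
    exists s, cxd J n \om s = t.
Proof.
have cohP A := coh_zero (eval_cx (CI_cx I J) A) n.
by split=> E0 A; have := E0 A; [apply: (proj1 (cohP A)) | apply: (proj2 (cohP A))].
Qed.

(** Evaluation at the identity identifies Hom(M_A, -) with [TrB] at A,
    compatibly with the differentials. *)
Lemma TrB_exact_MI (X : complex C) n :
  exact_at (TrB_map I (cxd X n)) (TrB_map I (cxd X n.+1)) <->
  forall A (t : mhom (MI I A) (X n.+1)), cxd X n.+1 \om t = 0 ->
    exists s, cxd X n \om s = t.
Proof.
split=> [ex A t dt|ex A x].
  have tT : t A (qproj I (idm A)) \in @trace C I (X n.+1) A.
    by apply/traceP; apply: MI_hom_killed.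
  have [|y /(congr1 (@sgval _ _)) /= yt] := proj1 (ex A (SubGrp tT)).
    by apply/val_inj; rewrite /= (mcompE dt).
  exists (elt_hom (elimT (traceP _) (sgvalP y))); apply: mhomP => B h.
  by rewrite /= mapp_nat yt -MI_homE.
split=> [/(congr1 (@sgval _ _)) /= dx|[y <-]]; last first.
  by apply/val_inj; rewrite /= cxd2E.
have kx := elimT (traceP _) (sgvalP x).
have [|s sx] := ex A (elt_hom kx).
  by apply: mhomP => B h; rewrite /= mapp_nat dx raddf0.
have sT : s A (qproj I (@idm C A)) \in @trace C I (X n) A.
  by apply/traceP; apply: MI_hom_killed.
exists (SubGrp sT); apply/val_inj; rewrite /= (mcompE sx).
exact: elt_hom_id.
Qed.

Lemma EXT_zero_TrB (G : module C) (J : inj_coresolution G) n :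
  zero_module (EXT I n.+1 J) <->
  exact_at (TrB_map I (cxd J n)) (TrB_map I (cxd J n.+1)).
Proof. by rewrite EXT_zero TrB_exact_MI. Qed.

(** A comparison map [w] between the two coresolutions is surjective on the
    cohomology of Hom(M_A, -). *)
Lemma EXT_zero_indep (G : module C) (J K : inj_coresolution G) n :
  zero_module (EXT I n.+1 J) -> zero_module (EXT I n.+1 K).
Proof.
have [_ monoJ exJ0 exJ] := icxP J; have [injK _ _ _] := icxP K.
have [w w_lifts] := comparison (mid G) monoJ exJ0
  (fun n => exJ n Logic.I) (fun n => injK n Logic.I).
move=> /EXT_zero exMI; apply/EXT_zero => A t dt.
have [x [z [dx ->]]] :=
  comparison_surj (icxP J) (icxP K) w_lifts (n := n) Logic.I dt.
have [y <-] := exMI A x dx.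
exists (w n \om y + z); apply: mhomP => B h.
by rewrite /= mappD cxmap_commE.
Qed.

End ExtVanishing.

(** * The canonical morphisms between Ext groups *)

Section Representable.
Variables (C : preadditive) (A : C).

Fact rep_act_is_additive B D (f : hom B D) :
  zmod_morphism (fun h : hom A B => f \oc h).
Proof. by move=> g h; apply: comp_subr. Qed.

Program Definition representable : module C :=
  @Module C (fun B => hom A B) (fun B D f => HB.pack (fun h : hom A B => f \oc h)
    (GRing.isZmodMorphism.Build _ _ _ (rep_act_is_additive f))) _ _ _.
Next Obligation. exact: comp_idl. Qed.
Next Obligation. by rewrite /= comp_assoc. Qed.
Next Obligation. exact: comp_addl. Qed.

Program Definition yoneda (M : module C) (x : M A) : mhom representable M :=
  @MHom C representable M (fun B (h : hom A B) => mact M h x) _ _.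
Next Obligation. by move=> g h; apply: mactB. Qed.
Next Obligation. exact: mact_comp. Qed.

Lemma yoneda_id (M : module C) (x : M A) : yoneda x A (idm A) = x.
Proof. exact: mact_id. Qed.

End Representable.

(** Bijectivity on cohomology, for a map induced by [g] on cocycles, in terms of
    cocycles alone. *)
Section CohomologyBijection.
Variables (X Y : cochain) (n : nat) (f : coh X n.+1 -> coh Y n.+1).
Variable g : {additive subgrp (cocycle X n.+1) -> subgrp (cocycle Y n.+1)}.
Hypothesis fg : forall x, f (coh_class x) = coh_class (g x).

Lemma coh_classB (Z : cochain) m (x y : subgrp (cocycle Z m)) :
  coh_class (x - y) = coh_class x - coh_class y.
Proof. by apply/eqP; rewrite eq_sym subr_eq -coh_classD subrK. Qed.

Lemma coh_surjP : bijective f ->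
  forall y, cdiff Y n.+1 y = 0 ->
    exists x z, y = sgval (g x) + cdiff Y n z.
Proof.
move=> [f' _ f'K] y /eqP yZ.
pose y' := @SubGrp _ (cocycle Y n.+1) y yZ.
pose x := repr (f' (coh_class y')).
have : coh_class (y' - g x) = 0.
  by rewrite coh_classB -fg coh_class_repr f'K subrr.
move=> /coh_eq0[z /= zP]; exists x, z.
by rewrite zP addrC subrK.
Qed.

Lemma coh_bij :
  (forall x y, sgval (g x) = cdiff Y n y ->
    exists x', sgval x = cdiff X n x') ->
  (forall y, cdiff Y n.+1 y = 0 -> exists x z, y = sgval (g x) + cdiff Y n z) ->
  bijective f.
Proof.
move=> inj surj.
have f_surj q : exists p, f p = q.
  rewrite -[q]coh_class_repr; set y := repr q.
  have [x [z yE]] := surj _ (eqP (sgvalP y)).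
  exists (coh_class x); rewrite fg; apply/esym/eqP.
  rewrite -subr_eq0 -coh_classB; apply/eqP/coh_eq0; exists z.
  by rewrite /= yE addrC addKr.
have f_inj : injective f.
  move=> p q; rewrite -[p]coh_class_repr -[q]coh_class_repr !fg => /eqP.
  rewrite -subr_eq0 -coh_classB -raddfB => /eqP/coh_eq0[y yE].
  apply/eqP; rewrite -subr_eq0 -coh_classB; apply/eqP/coh_eq0.
  by have [x' ->] := inj _ _ (esym yE); exists x'.
have f'P q : f (sval (cid (f_surj q))) = q := svalP (cid (f_surj q)).
by exists (fun q => sval (cid (f_surj q))) => [p|//]; apply: f_inj.
Qed.

End CohomologyBijection.

Section Phi.
Variables (C : preadditive) (I : ideal C) (G : module C).
Variables (J : inj_coresolution (TrB I G))
          (K : inj_coresolution (pi_mod (TrB I G))).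
Variables (L : inj_coresolution G).
Variables (u : complex_map (pi_aug J) K) (v : complex_map K L).

Definition phi_cocycle F n (x : subgrp (cocycle (hom_cx F J) n)) :
    subgrp (cocycle (hom_cx (pi_mod F) L) n) :=
  cocycle_map (hom_cx_map (pi_mod F) v)
    (cocycle_map (hom_cx_map (pi_mod F) u) (cocycle_map (pi_hom_cx F J) x)).

Fact phi_cocycle_is_additive F n : zmod_morphism (@phi_cocycle F n).
Proof. by move=> x y; rewrite /phi_cocycle !raddfB. Qed.
HB.instance Definition _ F n :=
  GRing.isZmodMorphism.Build _ _ (@phi_cocycle F n) (@phi_cocycle_is_additive F n).

Lemma phi_class F n (x : subgrp (cocycle (hom_cx F J) n)) :
  phi n F u v (coh_class x) = coh_class (phi_cocycle x).
Proof. by rewrite /phi /Ext_map /pi_Ext /= !coh_map_class. Qed.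

(** The components of v \om u : pi_* J -> L correspond under the adjunction to
    those of a morphism of complexes J -> TrB L. *)
Program Definition transpose : complex_map J (TrB_cx I L) :=
  @ComplexMap (quot_cat I) J (TrB_cx I L) (fun n => adjoint (v n \om u n)) _.
Next Obligation.
apply: mhomP => A x; apply/val_inj => /=.
by rewrite -(cxmap_commE v) -(cxmap_commE u).
Qed.

Lemma adjoint_phi_cocycle F n (x : subgrp (cocycle (hom_cx F J) n)) :
  adjoint (sgval (phi_cocycle x)) = transpose n \om sgval x.
Proof. by apply: mhomP => A y; apply/val_inj. Qed.

Hypothesis u_lifts : lifts (mid (pi_mod (TrB I G))) (pi_aug J) K u.
Hypothesis v_lifts : lifts (counit I G) K L v.

Lemma transpose_lifts : lifts (mid (TrB I G)) J (TrB_aug I L) transpose.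
Proof.
apply: mhomP => A x; apply/val_inj => /=.
have /= -> := mcompE u_lifts x.
by have /= -> := mcompE v_lifts x.
Qed.

(** [transpose] lifts the identity of TrB G, so the cone argument applies to it,
    and the adjunction carries the result back to Hom(pi_* F, L). *)
Lemma phi_bijective k F n : le_oo n.+1 k ->
  begins_injective_coresolution k (TrB_aug I L) -> bijective (phi n.+1 F u v).
Proof.
move=> le_nk beginsL; apply: (coh_bij (@phi_class F n.+1)) => [x y xy|y dy].
  apply: (comparison_inj (icxP J) beginsL transpose_lifts (k := k)
            (y := adjoint y)).
  - exact: le_oo_trans (leqnSn n) le_nk.
  - exact: (eqP (sgvalP x)).
  by rewrite -adjoint_phi_cocycle xy adjoint_post.
have [|x [z [dx yE]]] := comparison_surj (icxP J) beginsL transpose_lifts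
  (y := adjoint y) le_nk.
  by rewrite -adjoint_post [_ \om y]dy adjoint0.
have xZ : x \in cocycle (hom_cx F J) n.+1 by apply/eqP.
exists (SubGrp xZ), (unadjoint z); apply: adjoint_inj; rewrite adjointD.
by rewrite adjoint_phi_cocycle adjoint_post unadjointK.
Qed.

(** A cocycle of TrB L at A is a cocycle y of Hom(Hom(A, -), TrB L).  By
    surjectivity y is cohomologous to the image of a cocycle of
    Hom(Hom(A, -), J), and that one is a boundary once evaluated at the identity
    of A, since J is exact. *)
Lemma phi_rep_exact n :
  (forall A, bijective (phi n.+1 (representable (A : quot_cat I)) u v)) ->
  exact_at (TrB_map I (cxd L n)) (TrB_map I (cxd L n.+1)).
Proof.
have [_ _ _ exJ] := icxP J.
move=> phi_bij A x; split=> [dx|[y <-]]; last exact: (cxd2E (X := TrB_cx I L)).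
have [|s [z yE]] := @coh_surjP _ _ n _ (@phi_cocycle _ n.+1)
    (@phi_class _ n.+1) (phi_bij A) (unadjoint (yoneda x)).
  apply: adjoint_inj; rewrite adjoint_post unadjointK adjoint0.
  apply: mhomP => B h; apply: etrans (mapp_nat (TrB_map I (cxd L n.+1)) h x) _.
  by rewrite dx raddf0.
have [j jE] := proj1 (exJ n Logic.I A (sgval s A (idm A)))
  (mcompE (eqP (sgvalP s)) _).
exists (transpose n A j + adjoint z A (idm A)).
have <- : adjoint (unadjoint (yoneda x)) A (idm A) = x.
  by rewrite unadjointK yoneda_id.
rewrite yE adjointD adjoint_phi_cocycle adjoint_post mappD; congr (_ + _).
by rewrite -[LHS](cxmap_commE transpose) jE.
Qed.

End Phi.

Theorem proposition3p17 (C : preadditive) (I : ideal C) (G : module C)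
    (E : inj_coresolution G) (k : option nat) (hk : le_oo 1 k) :
  let a := begins_injective_coresolution k (TrB_aug I E) in
  let b := forall i : nat, (1 <= i)%N -> le_oo i k ->
    forall J : inj_coresolution G, zero_module (EXT I i J) in
  let c := forall (F : module (quot_cat I)) (i : nat), (1 <= i)%N -> le_oo i k ->
    forall (J : inj_coresolution (TrB I G))
           (K : inj_coresolution (pi_mod (TrB I G)))
           (L : inj_coresolution G)
           (u : complex_map (pi_aug J) K) (v : complex_map K L),
    lifts (mid (pi_mod (TrB I G))) (pi_aug J) K u -> lifts (counit I G) K L v ->
    bijective (phi i F u v) in
  (a <-> b) /\ (b <-> c).
Proof.
move=> a b c.
have begins_b (L : inj_coresolution G) :
    b -> begins_injective_coresolution k (TrB_aug I L).
  move=> EXT0; apply/(TrB_begins _ _ (icxP L)) => n le_nk.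
  exact/EXT_zero_TrB/EXT0.
split; split.
- move=> /(TrB_begins _ _ (icxP E)) ex [//|n] _ le_nk J.
  exact/(EXT_zero_indep (J := E))/EXT_zero_TrB/ex.
- exact: begins_b.
- move=> EXT0 F [//|n] _ le_nk J K L u v u_lifts v_lifts.
  exact: (phi_bijective u_lifts v_lifts F le_nk (begins_b L EXT0)).
(* The bijections are applied to coresolutions built from enough injectives. *)
move=> phi_bij [//|n] _ le_nk L; apply/EXT_zero_TrB.
pose J := inj_res (TrB I G); pose K := inj_res (pi_mod (TrB I G)).
have [_ monoJ exJ0 exJ] := icxP J; have [injK monoK exK0 exK] := icxP K.
have [injL _ _ _] := icxP L.
have [u u_lifts] := @comparison _ _ _ (pi_aug J) K (mid _) monoJ exJ0
  (fun n => exJ n Logic.I) (fun n => injK n Logic.I).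
have [v v_lifts] := comparison (counit I G) monoK exK0
  (fun n => exK n Logic.I) (fun n => injL n Logic.I).
apply: (phi_rep_exact (u := u) (v := v)) => A.
exact: phi_bij.
Qed.
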